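(* Let $\mathbb{K}\in\{\mathbb{R},\mathbb{C}\}$ and let $\Omega\in\mathbb{K}^{n\times\ell}$ be any full-rank random embedding. For any rank parameter $r\in\mathbb{N}$ with $r<\ell-\alpha_{\mathbb{K}}$ and any problem dimensions $d,p\in\mathbb{N}$ with $d\ge r$, $$\sup_{\substack{A\in\mathbb{K}^{n\times d},\ B\in\mathbb{K}^{n\times p}\\ \operatorname{rank}(A)=r,\ B\ne AA^+B}}\frac{\mathbb{E}\,\|B-A(\Omega^*A)^+(\Omega^*B)\|_{\rm F}^2}{\|B-AA^+B\|_{\rm F}^2}\ \ge\ 1+\frac{n-\ell}{n-r}\,\frac{r}{\ell-r-\alpha_{\mathbb{K}}}.$$
   Context: $\mathbb{K}$ is the field of real or complex numbers, and $\alpha_{\mathbb{K}}=1$ if $\mathbb{K}=\mathbb{R}$, $\alpha_{\mathbb{K}}=0$ if $\mathbb{K}=\mathbb{C}$. ${}^*$ is the adjoint (conjugate transpose), ${}^+$ is the Moore--Penrose pseudoinverse, $\|\cdot\|_{\rm F}$ is the Frobenius norm. All matrix dimensions ($n,\ell,d,p$) are positive integers. An embedding is a matrix in $\mathbb{K}^{n\times\ell}$ with $n\ge\ell$; a random embedding is a random such matrix with an arbitrary distribution; it is full-rank if its rank is $\ell$ (with probability one). The matrices $A,B$ in the supremum are deterministic and the expectation is over $\Omega$. Expectations and the supremum take values in $[0,\infty]$. *)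

(* Defs.v *)
From HB Require Import structures.
From mathcomp Require Export all_boot all_order all_algebra.
From mathcomp Require Export all_classical all_reals all_analysis.
From mathcomp Require Export complex.

Set Implicit Arguments.
Unset Strict Implicit.
Unset Printing Implicit Defensive.

Import Order.TTheory GRing.Theory Num.Theory.
Local Open Scope ring_scope.
Local Open Scope classical_set_scope.

Variant scalar_kind := RealK | ComplexK.

Definition scalar (R : realType) (k : scalar_kind) : numFieldType :=
  match k with
  | RealK => R
  | ComplexK => (R[i])%C
  end.

Definition alphaK (k : scalar_kind) : nat :=
  match k with RealK => 1%N | ComplexK => 0%N end.

Section Scalars.
Context {R : realType} {k : scalar_kind}.

Definition scalar_Re : scalar R k -> R :=
  match k return scalar R k -> R with
  | RealK => fun x => x
  | ComplexK => fun z : (R[i])%C => complex.Re z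
  end.

Definition scalar_Im : scalar R k -> R :=
  match k return scalar R k -> R with
  | RealK => fun=> 0
  | ComplexK => fun z : (R[i])%C => complex.Im z
  end.

Definition scalar_conj : scalar R k -> scalar R k :=
  match k return scalar R k -> scalar R k with
  | RealK => fun x => x
  | ComplexK => fun z : (R[i])%C => conjc z
  end.

(* The norm [`|x|] of the numFieldType [scalar R k] lies in [scalar R k];
   this is the same number as an element of [R]. *)
Definition modulus : scalar R k -> R :=
  match k return scalar R k -> R with
  | RealK => fun x : R => `|x|
  | ComplexK => fun z : (R[i])%C => Normc.normc z
  end.

End Scalars.

Section ScalarTheory.
Context {R : realType} {k : scalar_kind}.
Implicit Types x y : scalar R k.

Lemma scalar_conj_is_zmod_morphism : zmod_morphism (@scalar_conj R k).
Proof. by case: k => x y //=; rewrite rmorphB. Qed.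

Lemma scalar_conj_is_monoid_morphism : monoid_morphism (@scalar_conj R k).
Proof.
case: k; split=> //=; first exact: (rmorph1 (@conjc R)).
by move=> x y; rewrite rmorphM.
Qed.

HB.instance Definition _ :=
  GRing.isZmodMorphism.Build (scalar R k) (scalar R k) (@scalar_conj R k)
    scalar_conj_is_zmod_morphism.
HB.instance Definition _ :=
  GRing.isMonoidMorphism.Build (scalar R k) (scalar R k) (@scalar_conj R k)
    scalar_conj_is_monoid_morphism.

Lemma scalar_conjK : involutive (@scalar_conj R k).
Proof. by case: k => //= x; rewrite conjcK. Qed.

Lemma mul_scalar_conj x : x * scalar_conj x = `|x| ^+ 2.
Proof.
by move: x; case: k => /= x; [rewrite real_normK ?num_real// expr2 | rewrite sqr_normc].
Qed.

End ScalarTheory.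

Section Matrices.
Context {R : realType} {k : scalar_kind}.
Local Notation K := (scalar R k).

Definition adjmx m n (A : 'M[K]_(m, n)) : 'M[K]_(n, m) :=
  map_mx scalar_conj A^T.

Definition frobenius m n (A : 'M[K]_(m, n)) : R :=
  Num.sqrt (\sum_(i < m) \sum_(j < n) modulus (A i j) ^+ 2).

Definition penrose m n (A : 'M[K]_(m, n)) (X : 'M[K]_(n, m)) : Prop :=
  [/\ A *m X *m A = A,
      X *m A *m X = X,
      adjmx (A *m X) = A *m X
    & adjmx (X *m A) = X *m A].

(* The Moore--Penrose pseudoinverse; the default value [0] is never used, see
   [pinvP].  Not to be confused with the library's [pinvmx], which only
   satisfies part of the Penrose equations. *)
Definition pinv m n (A : 'M[K]_(m, n)) : 'M[K]_(n, m) :=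
  xget 0 [set X | penrose A X].

Lemma adjmxM m n p (A : 'M[K]_(m, n)) (B : 'M[K]_(n, p)) :
  adjmx (A *m B) = adjmx B *m adjmx A.
Proof. by rewrite /adjmx trmx_mul map_mxM. Qed.

Lemma adjmxK m n (A : 'M[K]_(m, n)) : adjmx (adjmx A) = A.
Proof. by apply/matrixP => i j; rewrite !mxE scalar_conjK. Qed.

Lemma adjmx_inv n (A : 'M[K]_n) : adjmx (invmx A) = invmx (adjmx A).
Proof. by rewrite /adjmx trmx_inv map_invmx. Qed.

Lemma mulmx_adj_eq0 m n (A : 'M[K]_(m, n)) : A *m adjmx A = 0 -> A = 0.
Proof.
move=> A0; apply/matrixP => i j; rewrite [RHS]mxE.
have /eqP := congr1 (fun M : 'M[K]_m => M i i) A0; rewrite !mxE.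
rewrite (eq_bigr (fun j => `|A i j| ^+ 2)); last first.
  by move=> h _; rewrite !mxE mul_scalar_conj.
rewrite psumr_eq0; last by move=> h _; rewrite exprn_ge0.
by move=> /allP/(_ j (mem_index_enum _)); rewrite expf_eq0 /= normr_eq0 => /eqP.
Qed.

Lemma row_free_gram m n (A : 'M[K]_(m, n)) :
  row_free A -> A *m adjmx A \in unitmx.
Proof.
move=> fA; rewrite -row_free_unit -kermx_eq0; apply/eqP.
set N := kermx _; have NA : N *m A = 0.
  apply: mulmx_adj_eq0; rewrite adjmxM mulmxA -(mulmxA N).
  by rewrite mulmx_ker mul0mx.
by apply: (row_free_inj fA); rewrite NA mul0mx.
Qed.

Lemma penrose_exists m n (A : 'M[K]_(m, n)) : exists X, penrose A X.
Proof.
move: (mulmx_base A) (row_base_free A) (col_base_full A).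
move: (\rank A) (col_base A) (row_base A) => q C D defA' fD fC.
have defA := esym defA'.
have uD : D *m adjmx D \in unitmx by exact: row_free_gram.
have uC : adjmx C *m C \in unitmx.
  rewrite -{2}[C]adjmxK; apply: row_free_gram.
  rewrite /adjmx /row_free mxrank_map mxrank_tr; exact: fC.
set G := D *m _ in uD; set H := adjmx C *m C in uC.
have hG : adjmx (invmx G) = invmx G by rewrite adjmx_inv adjmxM adjmxK.
have hH : adjmx (invmx H) = invmx H by rewrite adjmx_inv adjmxM adjmxK.
pose X := adjmx D *m invmx G *m invmx H *m adjmx C.
have AX : A *m X = C *m invmx H *m adjmx C.
  by rewrite defA /X !mulmxA -(mulmxA C D) -/G -(mulmxA C G) mulmxV// mulmx1.
have XA : X *m A = adjmx D *m invmx G *m D.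
  rewrite defA /X !mulmxA -(mulmxA _ (adjmx C) C) -/H.
  by rewrite -(mulmxA _ (invmx H) H) mulVmx// mulmx1.
exists X; split.
- rewrite AX defA !mulmxA -(mulmxA _ (adjmx C) C) -/H.
  by rewrite -(mulmxA _ (invmx H) H) mulVmx// mulmx1.
- rewrite XA /X !mulmxA -(mulmxA _ D (adjmx D)) -/G.
  by rewrite -(mulmxA _ (invmx G) G) mulVmx// mulmx1.
- by rewrite AX !adjmxM adjmxK hH mulmxA.
- by rewrite XA !adjmxM adjmxK hG mulmxA.
Qed.

Lemma penrose_uniq m n (A : 'M[K]_(m, n)) X Y :
  penrose A X -> penrose A Y -> X = Y.
Proof.
move=> [X1 X2 X3 X4] [Y1 Y2 Y3 Y4].
have AXY : A *m X = A *m Y.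
  have e : A *m Y *m (A *m X) = A *m X by rewrite mulmxA Y1.
  by rewrite -X3 -e adjmxM X3 Y3 mulmxA X1.
have XAY : X *m A = Y *m A.
  have e : X *m A *m (Y *m A) = X *m A by rewrite -mulmxA (mulmxA A) Y1.
  by rewrite -X4 -e adjmxM X4 Y4 -mulmxA (mulmxA A) X1.
by rewrite -X2 XAY -mulmxA AXY mulmxA Y2.
Qed.

Lemma pinvP m n (A : 'M[K]_(m, n)) : penrose A (pinv A).
Proof.
by have [X AX] := penrose_exists A; exact: (xgetPex 0 (ex_intro _ X AX)).
Qed.

(* Borel measurability of a [K]-valued random matrix, for an arbitrary law. *)
Definition random_matrix (disp : measure_display) (T : measurableType disp)
    m n (Omega : T -> 'M[K]_(m, n)) : Prop :=
  forall i j, measurable_fun setT (fun w => scalar_Re (Omega w i j)) /\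
              measurable_fun setT (fun w => scalar_Im (Omega w i j)).

End Matrices.

(* Main.v *)
(* The value at a full-rank [A] only depends on its column space, so one may take
   [A^* A = 1].  Let [Pi] be the orthogonal projection onto the range of [Omega] and
   [G = A^* Pi A].  Testing [B = e_1, ..., e_n] and summing, the Gauss-Markov theorem
   bounds the supremum from below in terms of [E tr G^-1]; it has to be shown that
   [E tr G^-1] cannot stay below [r b / a] for all [A], where
   [a = beta (l - r - alpha)], [b = beta (n - r - alpha)] and [beta = dim_R K].
   This is a maximum principle: on the Grassmannian, the Laplacian of [ln det G] is
   [2 (a tr G^-1 - r b)], so if [E tr G^-1 <= c < r b / a] everywhere then
   [E ln det G] is strictly superharmonic with a uniform margin, yet it cannot
   decrease forever.  To have this uniformly in spite of the singularity at
   [det G = 0], the logarithm is replaced by a polynomial that behaves like it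
   except on a region that is negligible on the logarithmic scale, and the Laplacian
   by second differences of step [t], where [t] is chosen so that the perturbed
   frames almost surely avoid [det G = 0]. *)
From HB Require Import structures.
Require Import Defs.
From mathcomp Require Import perm measurable_realfun ring lra zify.

Set Implicit Arguments.
Unset Strict Implicit.
Unset Printing Implicit Defensive.

Import Order.TTheory GRing.Theory Num.Theory.
Import numFieldNormedType.Exports.
Local Open Scope classical_set_scope.
Local Open Scope ring_scope.

(** * Scalars *)

(** For a Haar-distributed [A] the mean of [tr G^-1] is exactly [r b / a] for each fixed full-rank
    [Omega]; the maximum principle reaches this value from second differences alone. The obstacle is
    uniformity: [tr G^-1] and the derivatives of [ln det G] blow up where [det G] vanishes, and
    nothing controls how often the law of [Omega] comes near that. Multiplied by [det G], however,
    they stay bounded, being built from cofactors. Hence in the normalized variable [x = volratio] a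
    step [t] moves [x] by a bounded multiple of [t], and a polynomial in [x] has a Taylor remainder
    whose constant depends on the polynomial only. The price is that [x p'(x)] falls short of 1 for
    small [x]; but small [x] forces [tr G^-1] to be large, and its mean is at most [c], so the price
    is small on average. The constants are therefore fixed in this order: cutoff [Y] for [tr G^-1],
    quality [H] of the logarithm, polynomial, remainder constant, step size, decrease [th]. *)

Section Scalars.
Context {R : realType} {k : scalar_kind}.
Local Notation K := (scalar R k).
Implicit Types x y : K.

Definition ofR : R -> K :=
  match k return R -> scalar R k with
  | RealK => fun a => a
  | ComplexK => fun a => (a%:C)%C
  end.

Lemma ofR_is_zmod_morphism : zmod_morphism ofR.
Proof. by rewrite /ofR; case: k => a c //=; rewrite rmorphB. Qed.

Lemma ofR_is_monoid_morphism : monoid_morphism ofR.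
Proof. by rewrite /ofR; case: k; split=> //= a c; rewrite rmorphM. Qed.

HB.instance Definition _ :=
  GRing.isZmodMorphism.Build R K ofR ofR_is_zmod_morphism.
HB.instance Definition _ :=
  GRing.isMonoidMorphism.Build R K ofR ofR_is_monoid_morphism.

Lemma scalar_Re_is_zmod_morphism : zmod_morphism (@scalar_Re R k).
Proof. by rewrite /scalar_Re; case: k => [//|[a b] [c d]]. Qed.

HB.instance Definition _ :=
  GRing.isZmodMorphism.Build K R (@scalar_Re R k) scalar_Re_is_zmod_morphism.

Lemma scalar_ReK (a : R) : scalar_Re (ofR a) = a.
Proof. by rewrite /ofR /scalar_Re; case: k. Qed.

Lemma ofR_inj : injective ofR.
Proof. exact: can_inj scalar_ReK. Qed.

Lemma scalar_conj_ofR (a : R) : scalar_conj (ofR a) = ofR a.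
Proof. by rewrite /ofR /scalar_conj; case: k => //=; rewrite oppr0. Qed.

Lemma scalar_Re_conj x : scalar_Re (scalar_conj x) = scalar_Re x.
Proof. by move: x; rewrite /scalar_Re /scalar_conj; case: k => [//|[c d]]. Qed.

Lemma add_scalar_conj x : x + scalar_conj x = ofR (2 * scalar_Re x).
Proof.
move: x; rewrite /ofR /scalar_Re /scalar_conj; case: k => /= [x|[c d]].
  by rewrite mulr_natl mulr2n.
by rewrite /GRing.add /= subrr mulr_natl mulr2n.
Qed.

Lemma mul_conj_modulus x : x * scalar_conj x = ofR (modulus x ^+ 2).
Proof.
rewrite mul_scalar_conj; move: x; rewrite /ofR /modulus; case: k => //= x.
by rewrite rmorphXn.
Qed.

Lemma modulus_ge0 x : 0 <= modulus x.
Proof.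
move: x; rewrite /modulus; case: k => //= -[c d] /=.
exact: sqrtr_ge0.
Qed.

Lemma modulusM : {morph @modulus R k : x y / x * y}.
Proof.
rewrite /modulus; case: k => x y; first exact: normrM.
exact: Normc.normcM.
Qed.

Lemma modulus_ofR (a : R) : modulus (ofR a) = `|a|.
Proof.
by rewrite /ofR /modulus; case: k => //=; rewrite expr0n addr0 sqrtr_sqr.
Qed.

Lemma modulus1 : modulus (1 : K) = 1.
Proof. by rewrite -(rmorph1 ofR) modulus_ofR normr1. Qed.

Lemma modulus0 : modulus (0 : K) = 0.
Proof. by rewrite -(rmorph0 ofR) modulus_ofR normr0. Qed.

Lemma modulus_eq0 x : (modulus x == 0) = (x == 0).
Proof.
apply/eqP/eqP => [x0|->]; last exact: modulus0.
move/eqP: (mul_scalar_conj x).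
rewrite mul_conj_modulus x0 expr0n /= rmorph0 eq_sym sqrf_eq0 normr_eq0.
by move/eqP.
Qed.

Lemma modulus_gt0 x : (0 < modulus x) = (x != 0).
Proof. by rewrite lt_def modulus_ge0 modulus_eq0 andbT. Qed.

Lemma modulusV x : modulus x^-1 = (modulus x)^-1.
Proof.
have [->|x0] := eqVneq x 0; first by rewrite invr0 modulus0 invr0.
have mx0 : modulus x != 0 by rewrite modulus_eq0.
by apply: (mulfI mx0); rewrite -modulusM !divff// modulus1.
Qed.

Lemma modulus_conj x : modulus (scalar_conj x) = modulus x.
Proof.
apply/eqP; rewrite -(eqrXn2 (isT : (0 < 2)%N)) ?modulus_ge0//; apply/eqP.
by apply: ofR_inj; rewrite -!mul_conj_modulus scalar_conjK mulrC.
Qed.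

Lemma modulusD x y : modulus (x + y) <= modulus x + modulus y.
Proof.
move: x y; rewrite /modulus; case: k => x y; first exact: ler_normD.
exact: le_normcD.
Qed.

Lemma modulus_sum I (s : seq I) (Q : pred I) (F : I -> K) :
  modulus (\sum_(i <- s | Q i) F i) <= \sum_(i <- s | Q i) modulus (F i).
Proof.
elim/big_rec2: _ => [|i y z _ h]; first by rewrite modulus0.
by apply: le_trans (modulusD _ _) _; rewrite lerD2l.
Qed.

Lemma modulus_prod I (s : seq I) (Q : pred I) (F : I -> K) :
  modulus (\prod_(i <- s | Q i) F i) = \prod_(i <- s | Q i) modulus (F i).
Proof. exact: (big_morph _ modulusM modulus1). Qed.

Lemma modulusX x m : modulus (x ^+ m) = modulus x ^+ m.
Proof. by elim: m => [|m IH]; rewrite ?modulus1// !exprS modulusM IH. Qed.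

Lemma scalar_Re_sqr_le x : scalar_Re x ^+ 2 <= modulus x ^+ 2.
Proof.
move: x; rewrite /scalar_Re /modulus; case: k => /= [x|[c d] /=].
  by rewrite real_normK ?num_real.
by rewrite sqr_sqrtr ?addr_ge0 ?sqr_ge0// lerDl sqr_ge0.
Qed.

(* An orthonormal basis of [K] as a real inner product space, padded with the
   zero vector when [K] is real. *)
Definition unit_dir (b : bool) : K :=
  match k return scalar R k with
  | RealK => if b then 1 else 0
  | ComplexK => if b then 1 else ('i)%C
  end.

Lemma sum_Re_unit_dir x :
  \sum_b scalar_Re (x * unit_dir b) ^+ 2 = modulus x ^+ 2.
Proof.
rewrite big_bool /=.
move: x; rewrite /unit_dir /scalar_Re /modulus; case: k => /= [x|[c d] /=].
  by rewrite mulr1 mulr0 expr0n addr0 real_normK ?num_real.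
rewrite sqr_sqrtr ?addr_ge0 ?sqr_ge0//; ring.
Qed.

(** The value is the real dimension of [K]. Its contrast with the coefficient 1 in [sum_Re_unit_dir]
    is what finally produces [alphaK] in the bound. *)
Lemma sum_modulus_unit_dir :
  \sum_b modulus (unit_dir b) ^+ 2 = 2 - (alphaK k)%:R.
Proof.
rewrite big_bool /=; rewrite /unit_dir /modulus; case: k => /=.
  by rewrite normr1 normr0; ring.
rewrite !sqr_sqrtr ?addr_ge0 ?sqr_ge0//; ring.
Qed.

Lemma modulus_unit_dir_le1 b : modulus (unit_dir b) <= 1.
Proof.
rewrite /unit_dir /modulus; case: k b => -[] /=; rewrite ?normr1 ?normr0//.
- by rewrite expr1n expr0n addr0 sqrtr1.
- by rewrite expr1n expr0n add0r sqrtr1.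
Qed.

End Scalars.
Arguments ofR {R k}.

(** * Matrices *)

Section Determinants.
Context {F : comUnitRingType}.

(** Sylvester's identity: the two sides are the two Schur complements of the block matrix [B]. *)
Lemma det_1mulmx_comm m n (U : 'M[F]_(m, n)) (V : 'M[F]_(n, m)) :
  \det (1%:M + U *m V) = \det (1%:M + V *m U).
Proof.
pose B := block_mx (1%:M : 'M[F]_m) (- U) V (1%:M : 'M[F]_n).
have dB : \det B = \det (1%:M + U *m V).
  have E : B *m block_mx 1%:M 0 (- V) 1%:M = block_mx (1%:M + U *m V) (- U) 0 1%:M.
    by rewrite mulmx_block !mulmx1 !mul1mx !mulmx0 !mulNmx !mulmxN opprK subrr !add0r.
  have := congr1 determinant E.
  by rewrite det_mulmx det_lblock det_ublock !det1 !mulr1.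
rewrite -dB.
have E : block_mx 1%:M 0 (- V) 1%:M *m B = block_mx 1%:M (- U) 0 (1%:M + V *m U).
  rewrite mulmx_block !mulmx1 !mul1mx !mul0mx !addr0.
  by rewrite !mulNmx !mulmxN opprK addNr addrC.
have := congr1 determinant E.
by rewrite det_mulmx det_lblock det_ublock !det1 !mul1r.
Qed.

Lemma det_mx22 (M : 'M[F]_2) : \det M = M 0 0 * M 1 1 - M 0 1 * M 1 0.
Proof.
rewrite (expand_det_row _ 0) !big_ord_recl big_ord0 /cofactor !det_mx11 !mxE /=.
rewrite expr0 mul1r addr0 expr1 mulN1r mulrN.
by congr (_ * M _ _ - M _ _ * M _ _); apply/val_inj.
Qed.

Lemma det_add_mulmx m n (G : 'M[F]_m) (U : 'M[F]_(m, n)) (V : 'M[F]_(n, m)) :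
  G \in unitmx ->
  \det (G + U *m V) = \det G * \det (1%:M + V *m invmx G *m U).
Proof.
move=> uG; rewrite -mulmxA -det_1mulmx_comm -mulmxA -det_mulmx mulmxDr mulmx1.
by rewrite !mulmxA mulmxV// mul1mx.
Qed.

End Determinants.

Section SquaredNorm.
Context {R : realType} {k : scalar_kind}.
Local Notation K := (scalar R k).

Definition sqnorm m n (M : 'M[K]_(m, n)) : R :=
  \sum_(i < m) \sum_(j < n) modulus (M i j) ^+ 2.

Lemma sqnorm_ge0 m n (M : 'M[K]_(m, n)) : 0 <= sqnorm M.
Proof. by do 2!apply: sumr_ge0 => ? _; rewrite sqr_ge0. Qed.

Lemma frobenius_sqr m n (M : 'M[K]_(m, n)) : frobenius M ^+ 2 = sqnorm M.
Proof. by rewrite sqr_sqrtr// sqnorm_ge0. Qed.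

Lemma sqnorm_trace m n (M : 'M[K]_(m, n)) : ofR (sqnorm M) = \tr (M *m adjmx M).
Proof.
rewrite rmorph_sum; apply: eq_bigr => i _; rewrite mxE rmorph_sum.
by apply: eq_bigr => j _; rewrite !mxE mul_conj_modulus.
Qed.

Lemma sqnorm_eq0 m n (M : 'M[K]_(m, n)) : (sqnorm M == 0) = (M == 0).
Proof.
apply/eqP/eqP => [M0|->]; last first.
  by rewrite /sqnorm !big1// => i _; rewrite big1// => j _; rewrite mxE modulus0 expr0n.
apply/matrixP => i j; rewrite mxE; apply/eqP.
have := psumr_eq0P (fun i _ => sumr_ge0 _ (fun j _ => sqr_ge0 (modulus (M i j)))) M0.
move=> /(_ i isT) /(psumr_eq0P (fun j _ => sqr_ge0 (modulus (M i j)))) /(_ j isT).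
by move/eqP; rewrite sqrf_eq0 modulus_eq0.
Qed.

Lemma adjmxD m n (M N : 'M[K]_(m, n)) : adjmx (M + N) = adjmx M + adjmx N.
Proof. by rewrite /adjmx linearD /= map_mxD. Qed.

Lemma adjmxB m n (M N : 'M[K]_(m, n)) : adjmx (M - N) = adjmx M - adjmx N.
Proof. by rewrite /adjmx linearB /= map_mxB. Qed.

Lemma adjmxZ m n (a : K) (M : 'M[K]_(m, n)) :
  adjmx (a *: M) = scalar_conj a *: adjmx M.
Proof. by rewrite /adjmx linearZ /= map_mxZ. Qed.

Lemma adjmx1 n : adjmx (1%:M : 'M[K]_n) = 1%:M.
Proof. by rewrite /adjmx trmx1 map_mx1. Qed.

Lemma adjmx0 m n : adjmx (0 : 'M[K]_(m, n)) = 0.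
Proof. by rewrite /adjmx trmx0 map_mx0. Qed.

Lemma adjmx_delta m n i j : adjmx (delta_mx i j : 'M[K]_(m, n)) = delta_mx j i.
Proof. by rewrite /adjmx trmx_delta map_delta_mx. Qed.

Lemma sqnorm_adj m n (M : 'M[K]_(m, n)) : sqnorm (adjmx M) = sqnorm M.
Proof.
by rewrite /sqnorm exchange_big; do 2!apply: eq_bigr => ? _; rewrite !mxE modulus_conj.
Qed.

Lemma sqnormZ m n (a : K) (M : 'M[K]_(m, n)) :
  sqnorm (a *: M) = modulus a ^+ 2 * sqnorm M.
Proof.
rewrite /sqnorm mulr_sumr; apply: eq_bigr => i _; rewrite mulr_sumr.
by apply: eq_bigr => j _; rewrite mxE modulusM exprMn.
Qed.

Lemma sqnormD_orth m n (M N : 'M[K]_(m, n)) :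
  N *m adjmx M = 0 -> sqnorm (M + N) = sqnorm M + sqnorm N.
Proof.
move=> NM; have MN : M *m adjmx N = 0 by rewrite -[LHS]adjmxK adjmxM adjmxK NM adjmx0.
apply: (@ofR_inj R k); rewrite rmorphD /= !sqnorm_trace adjmxD mulmxDl !mulmxDr NM MN.
by rewrite addr0 add0r linearD.
Qed.

Lemma sqnorm_cols m n (M : 'M[K]_(m, n)) : sqnorm M = \sum_j sqnorm (col j M).
Proof.
rewrite /sqnorm exchange_big /=; apply: eq_bigr => j _; apply: eq_bigr => i _.
by rewrite big_ord1 mxE.
Qed.

Lemma sqnorm_mulmx_delta m n p (M : 'M[K]_(m, n)) i (j : 'I_p) :
  sqnorm (M *m delta_mx i j) = sqnorm (col i M).
Proof.
apply: eq_bigr => a _; rewrite big_ord1 (bigD1 j)//= big1 ?addr0.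
  rewrite !mxE (bigD1 i)//= big1 ?addr0; first by rewrite !mxE !eqxx mulr1.
  by move=> b /negPf bi; rewrite mxE bi mulr0.
move=> b /negPf bj; rewrite mxE big1 ?modulus0 ?expr0n// => c _.
by rewrite mxE bj andbF mulr0.
Qed.

Definition is_proj n (Q : 'M[K]_n) : Prop := adjmx Q = Q /\ Q *m Q = Q.

Lemma is_proj_sqnorm n (Q : 'M[K]_n) : is_proj Q -> ofR (sqnorm Q) = \tr Q.
Proof. by move=> [Qh Qi]; rewrite sqnorm_trace Qh Qi. Qed.

Lemma is_proj_compl n (Q : 'M[K]_n) : is_proj Q -> is_proj (1%:M - Q).
Proof.
move=> [Qh Qi]; split; first by rewrite adjmxB adjmx1 Qh.
by rewrite mulmxBr mulmx1 mulmxBl mul1mx Qi subrr subr0.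
Qed.

Lemma is_proj_sqnorm_split n m (Q : 'M[K]_n) (M : 'M[K]_(n, m)) : is_proj Q ->
  sqnorm M = sqnorm (Q *m M) + sqnorm ((1%:M - Q) *m M).
Proof.
move=> Qp; have [Qh Qi] := Qp.
rewrite -(sqnorm_adj M) -(sqnorm_adj (Q *m M)) -(sqnorm_adj (_ *m M)).
rewrite -sqnormD_orth; first by rewrite -adjmxD -mulmxDl addrC subrK mul1mx.
rewrite adjmxK adjmxM (is_proj_compl Qp).1 mulmxA -(mulmxA (adjmx M)).
by rewrite mulmxBl mul1mx Qi subrr mulmx0 mul0mx.
Qed.

Lemma is_proj_sqnorm_le n m (Q : 'M[K]_n) (M : 'M[K]_(n, m)) : is_proj Q ->
  sqnorm (Q *m M) <= sqnorm M.
Proof. by move=> Qp; rewrite (is_proj_sqnorm_split M Qp) lerDl sqnorm_ge0. Qed.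

Lemma modulus_entry_le m n (M : 'M[K]_(m, n)) i j :
  modulus (M i j) ^+ 2 <= sqnorm M.
Proof.
rewrite /sqnorm (bigD1 i)//= (bigD1 j)//= -!addrA lerDl addr_ge0//.
  by apply: sumr_ge0 => ? _; rewrite sqr_ge0.
by do 2!apply: sumr_ge0 => ? _; rewrite sqr_ge0.
Qed.

Lemma modulus_gram_le m n (M : 'M[K]_(m, n)) (i j : 'I_m) (a : R) :
  (forall i, sqnorm (row i M) <= a) -> modulus ((M *m adjmx M) i j) <= a.
Proof.
move=> Ma; rewrite mxE.
have Mi i0 : \sum_h modulus (M i0 h) ^+ 2 <= a.
  by apply: le_trans (Ma i0); rewrite /sqnorm big_ord1; apply: ler_sum => h _; rewrite mxE.
apply: (le_trans (modulus_sum _ _ _)).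
have -> : a = (a + a) / 2 by field.
apply: (@le_trans _ _ (\sum_h (modulus (M i h) ^+ 2 + modulus (M j h) ^+ 2) / 2)).
  apply: ler_sum => h _; rewrite !mxE modulusM modulus_conj.
  have := sqr_ge0 (modulus (M i h) - modulus (M j h)); lra.
by rewrite -mulr_suml big_split /= ler_wpM2r ?invr_ge0// lerD.
Qed.

(** Leibniz expansion, cruder than Hadamard's inequality; any bound uniform in the frame is enough.
    The factorials in [volratio] and in the later estimates come from here. *)
Lemma modulus_det_le n (M : 'M[K]_n) (a : R) :
  (forall i j, modulus (M i j) <= a) -> modulus (\det M) <= n`!%:R * a ^+ n.
Proof.
move=> Ma; apply: (le_trans (modulus_sum _ _ _)).
apply: (@le_trans _ _ (\sum_(s : 'S_n) a ^+ n)); last first.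
  by rewrite sumr_const card_Sn mulr_natl.
apply: ler_sum => s _; rewrite modulusM modulusX modulus_prod.
rewrite (_ : modulus (-1) = 1) ?expr1n ?mul1r; last first.
  by rewrite -(rmorph1 ofR) -rmorphN modulus_ofR normrN normr1.
rewrite -[X in _ ^+ X]card_ord -prodr_const; apply: ler_prod => i _.
by rewrite modulus_ge0 Ma.
Qed.

End SquaredNorm.

(** * Local geometry of the frames *)

Lemma det_block_mx11 (F : comUnitRingType) (a b c d : 'M[F]_1) :
  \det (block_mx a b c d) = a 0 0 * d 0 0 - b 0 0 * c 0 0.
Proof.
rewrite (det_mx22 (block_mx a b c d)).
have E0 : (0 : 'I_2) = lshift 1 (0 : 'I_1) by apply/val_inj.
have E1 : (1 : 'I_2) = rshift 1 (0 : 'I_1) by apply/val_inj.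
by rewrite E0 E1 (block_mxEul a b c d) (block_mxEdr a b c d)
           (block_mxEur a b c d) (block_mxEdl a b c d).
Qed.

Section Compression.
Context {R : realType} {k : scalar_kind}.
Local Notation K := (scalar R k).

Definition compress n r (P : 'M[K]_n) (A : 'M[K]_(n, r)) : 'M[K]_r :=
  adjmx A *m P *m A.

(** Moving column [i] of [A] by [t u] changes [G] by a matrix of rank at most two, so the ratio of
    determinants is a 2 by 2 determinant and an exact quadratic in [t]. The last factor is the
    quadratic form of [schur_proj]. *)
Lemma det_compress_update n r (P : 'M[K]_n) (A : 'M[K]_(n, r)) (u : 'cV[K]_n)
    (i : 'I_r) (t : R) (G := compress P A)
    (y := (invmx G *m adjmx A *m P *m u) i 0) :
  adjmx P = P -> G \in unitmx ->
  \det (compress P (A + ofR t *: (u *m delta_mx 0 i))) =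
  \det G * ((1 + ofR t * y) * (1 + ofR t * scalar_conj y)
    + ofR t ^+ 2 * invmx G i i
      * (adjmx u *m (P - P *m A *m invmx G *m adjmx A *m P) *m u) 0 0).
Proof.
move=> Ph uG.
have Gh : adjmx (invmx G) = invmx G by rewrite adjmx_inv !adjmxM adjmxK Ph mulmxA.
pose e : 'M[K]_(1, r) := delta_mx 0 i.
have eh : adjmx e = delta_mx i 0 by rewrite adjmx_delta.
set mu := (adjmx u *m P *m u) 0 0.
have muM : adjmx u *m P *m u = mu%:M by exact: mx11_scalar.
set T := ofR t.
have Th : scalar_conj T = T by rewrite scalar_conj_ofR.
(* The increment of [G] has two terms linear in [T] and the term [T ^+ 2 * mu] at entry [(i, i)];
   the latter is absorbed into the first row of [V] to keep the rank at two. *)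
pose U := row_mx (adjmx e) (adjmx A *m P *m u).
pose V := col_mx (T *: (adjmx u *m P *m A) + (T ^+ 2 * mu) *: e) (T *: e).
have -> : compress P (A + T *: (u *m delta_mx 0 i)) = G + U *m V.
  rewrite /compress /U /V mul_row_col adjmxD adjmxZ adjmxM Th.
  rewrite !mulmxDl !mulmxDr -/e -/G -!addrA; congr (_ + _).
  rewrite addrC addrA; congr (_ + _ + _).
  - by rewrite -!scalemxAl -scalemxAr !mulmxA.
  - rewrite -!scalemxAl -!scalemxAr scalerA -expr2 -[RHS]scalerA; congr (_ *: _).
    by rewrite scalemxAl -mul_mx_scalar -muM !mulmxA.
  - by rewrite -!scalemxAr !mulmxA.
rewrite det_add_mulmx//; congr (_ * _).
rewrite /U /V -mulmxA mul_mx_row mul_col_row (scalar_mx_block 1 1) add_block_mx.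
rewrite det_block_mx11 -/mu.
have ee : (e *m invmx G *m adjmx e) 0 0 = invmx G i i.
  by rewrite eh -rowE -colE !mxE.
have ey : (e *m invmx G *m (adjmx A *m P *m u)) 0 0 = y.
  by rewrite /y -rowE !mulmxA -!row_mul mxE.
have ye : (adjmx u *m P *m A *m invmx G *m adjmx e) 0 0 = scalar_conj y.
  have -> : adjmx u *m P *m A *m invmx G *m adjmx e =
    adjmx (e *m invmx G *m (adjmx A *m P *m u)).
    by rewrite !adjmxM adjmxK Gh Ph !mulmxA.
  by rewrite -ey [LHS]mxE; congr scalar_conj; rewrite mxE.
set z := (adjmx u *m P *m A *m invmx G *m (adjmx A *m P *m u)) 0 0.
have zE : (adjmx u *m (P - P *m A *m invmx G *m adjmx A *m P) *m u) 0 0 = mu - z.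
  by rewrite mulmxBr mulmxBl /mu /z !mulmxA !mxE.
rewrite zE !mulmxDl -!scalemxAl.
move: ee ey ye; rewrite /z -!(mulmxA _ (invmx G)).
set m1 := e *m (invmx G *m adjmx e); set m2 := e *m (invmx G *m _).
set m3 := _ *m (invmx G *m adjmx e); set m4 := _ *m (invmx G *m _).
clearbody m1 m2 m3 m4 => ee ey ye; rewrite !mxE ee ey ye eqxx /=. ring.
Qed.

Lemma modulus_one_add (t : R) (y : K) (c : R) : 0 <= c ->
  modulus ((1 + ofR t * y) * (1 + ofR t * scalar_conj y) + ofR c) =
  1 + 2 * t * scalar_Re y + t ^+ 2 * modulus y ^+ 2 + c.
Proof.
move=> c0; have -> : (1 + ofR t * y) * (1 + ofR t * scalar_conj y) =
    ofR (modulus (1 + ofR t * y) ^+ 2).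
  by rewrite -mul_conj_modulus rmorphD rmorphM rmorph1 /= scalar_conj_ofR.
rewrite -rmorphD modulus_ofR ger0_norm ?addr_ge0 ?sqr_ge0//.
congr (_ + _); apply: (@ofR_inj R k); rewrite -mul_conj_modulus.
rewrite !rmorphD rmorphM /= !rmorph1 scalar_conj_ofR.
rewrite [_ (t ^+ 2 * _)]rmorphM [_ (2 * t * _)]rmorphM [_ (2 * t)]rmorphM /=.
rewrite rmorphXn /= -mul_conj_modulus.
have := add_scalar_conj y; rewrite rmorphM /= => E.
transitivity (1 + ofR t * (y + scalar_conj y) + ofR t ^+ 2 * (y * scalar_conj y)).
  by ring.
by rewrite E; ring.
Qed.

Lemma is_proj_quad n (Q : 'M[K]_n) (u : 'cV[K]_n) : is_proj Q ->
  (adjmx u *m Q *m u) 0 0 = ofR (sqnorm (Q *m u)).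
Proof.
move=> [Qh Qi]; rewrite sqnorm_trace mxtrace_mulC adjmxM Qh mulmxA.
by rewrite -(mulmxA _ Q Q) Qi trace_mx11.
Qed.

Lemma sum_sqnorm_unit_dir m n (M : 'M[K]_(m, n)) :
  \sum_j \sum_b sqnorm (M *m (unit_dir b *: delta_mx j (0 : 'I_1))) =
  (2 - (alphaK k)%:R) * sqnorm M.
Proof.
rewrite (sqnorm_cols M) mulr_sumr; apply: eq_bigr => j _.
rewrite -(@sum_modulus_unit_dir R k) mulr_suml; apply: eq_bigr => b _.
by rewrite -scalemxAr sqnormZ sqnorm_mulmx_delta.
Qed.

End Compression.

Section LocalGeometry.
Context {R : realType} {k : scalar_kind} (n r : nat).
Local Notation K := (scalar R k).
Variables (P : 'M[K]_n) (A : 'M[K]_(n, r)).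
Hypotheses (Pproj : is_proj P) (Aorth : adjmx A *m A = 1%:M).
Local Notation G := (compress P A).
Hypothesis uG : G \in unitmx.
Local Notation beta := (2 - (alphaK k)%:R : R).

(* The best linear unbiased estimator: the left inverse of [A] of least norm
   among those that factor through [P]. *)
Definition blue : 'M[K]_(r, n) := invmx G *m adjmx A *m P.
(** The orthogonal projection onto the complement of the range of [P A] inside the range of [P]. *)
Definition schur_proj : 'M[K]_n := P - P *m A *m invmx G *m adjmx A *m P.
Definition ortho_proj : 'M[K]_n := 1%:M - A *m adjmx A.
(** Projected coordinate vectors: over all [j] and [b] they form a tight frame, not a basis, of the
    orthogonal complement of the range of [A]. That is enough for sums of quadratic forms over them
    to be traces. *)
Definition direction (j : 'I_n) (b : bool) : 'cV[K]_n :=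
  ortho_proj *m (unit_dir b *: delta_mx j 0).

Lemma compress_herm : adjmx G = G.
Proof. by rewrite !adjmxM adjmxK Pproj.1 mulmxA. Qed.

Lemma invmx_compress_herm : adjmx (invmx G) = invmx G.
Proof. by rewrite adjmx_inv compress_herm. Qed.

Lemma blueA : blue *m A = 1%:M.
Proof. by rewrite /blue -!mulmxA (mulmxA (adjmx A)) mulVmx. Qed.

Lemma blue_proj : blue *m P = blue.
Proof. by rewrite /blue -(mulmxA _ P P) Pproj.2. Qed.

Lemma blue_adj : blue *m adjmx blue = invmx G.
Proof.
rewrite {2}/blue !adjmxM adjmxK Pproj.1 invmx_compress_herm !mulmxA.
by rewrite blue_proj blueA mul1mx.
Qed.

Lemma sqnorm_row_blue i : ofR (sqnorm (row i blue)) = invmx G i i.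
Proof.
rewrite sqnorm_trace trace_mx11 -blue_adj !mxE.
by apply: eq_bigr => j _; rewrite !mxE.
Qed.

Lemma ortho_proj_proj : is_proj ortho_proj.
Proof.
apply: is_proj_compl; split; first by rewrite adjmxM adjmxK.
by rewrite -mulmxA (mulmxA (adjmx A)) Aorth mul1mx.
Qed.

Lemma adj_ortho_proj : adjmx A *m ortho_proj = 0.
Proof. by rewrite mulmxBr mulmx1 mulmxA Aorth mul1mx subrr. Qed.

Lemma sqnorm_ortho_proj : sqnorm ortho_proj = n%:R - r%:R.
Proof.
apply: (@ofR_inj R k); rewrite is_proj_sqnorm; last exact: ortho_proj_proj.
by rewrite linearB /= mxtrace1 mxtrace_mulC Aorth mxtrace1 rmorphB /= !rmorph_nat.
Qed.

Lemma schur_projA : schur_proj *m A = 0.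
Proof.
have E : P *m A *m invmx G *m adjmx A *m P *m A = P *m A *m (invmx G *m G).
  by rewrite /compress !mulmxA.
by rewrite mulmxBl E mulVmx// mulmx1 subrr.
Qed.

Lemma schur_proj_proj : is_proj schur_proj.
Proof.
have [Ph Pi] := Pproj; split.
  by rewrite adjmxB !adjmxM adjmxK Ph invmx_compress_herm !mulmxA.
rewrite {2}/schur_proj mulmxBr !mulmxA.
have -> : schur_proj *m P = schur_proj.
  by rewrite /schur_proj mulmxBl -(mulmxA _ P P) Pi.
by rewrite schur_projA !mul0mx subr0.
Qed.

Lemma schur_proj_ortho : schur_proj *m ortho_proj = schur_proj.
Proof. by rewrite mulmxBr mulmx1 mulmxA schur_projA mul0mx subr0. Qed.

Lemma sqnorm_schur_proj (l : nat) :
  \tr P = l%:R -> sqnorm schur_proj = l%:R - r%:R.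
Proof.
move=> trP; apply: (@ofR_inj R k).
rewrite is_proj_sqnorm; last exact: schur_proj_proj.
rewrite linearB /= trP rmorphB /= !rmorph_nat; congr (_ - _).
have -> : P *m A *m invmx G *m adjmx A *m P = (P *m A) *m blue.
  by rewrite /blue !mulmxA.
by rewrite mxtrace_mulC mulmxA blue_proj blueA mxtrace1.
Qed.

Lemma sum_schur_direction (l : nat) : \tr P = l%:R ->
  \sum_j \sum_b sqnorm (schur_proj *m direction j b) = beta * (l%:R - r%:R).
Proof.
move=> trP; rewrite -(sqnorm_schur_proj trP) -sum_sqnorm_unit_dir.
by do 2!apply: eq_bigr => ? _; rewrite mulmxA schur_proj_ortho.
Qed.

Lemma sum_direction :
  \sum_j \sum_b sqnorm (direction j b) = beta * (n%:R - r%:R).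
Proof. by rewrite -sqnorm_ortho_proj -sum_sqnorm_unit_dir. Qed.

(** Twice its real part is the derivative of [ln det G] when column [i] moves along
    [direction j b]. *)
Definition slope i j b : K := (blue *m direction j b) i 0.

Lemma slopeE i j b : slope i j b = (blue *m ortho_proj) i j * unit_dir b.
Proof.
by rewrite /slope mulmxA -scalemxAr mxE -colE mulrC [X in X * _]mxE.
Qed.

(** Pythagoras: the component of row [i] of [blue] in the range of [A] is given by row [i] of
    [blue *m A = 1], which has norm 1. *)
Lemma sqnorm_row_blue_ortho i :
  sqnorm (row i (blue *m ortho_proj)) = sqnorm (row i blue) - 1.
Proof.
rewrite row_mul -(sqnorm_adj (row i blue)).
rewrite (is_proj_sqnorm_split (adjmx (row i blue)) ortho_proj_proj).
rewrite -[ortho_proj in LHS]ortho_proj_proj.1 -[row i blue in LHS]adjmxK -adjmxM sqnorm_adj.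
suff -> : sqnorm ((1%:M - ortho_proj) *m adjmx (row i blue)) = 1 by rewrite addrK.
rewrite opprB addrC subrK -[RHS]mulr1 -mulmxA -adjmxM -row_mul blueA.
apply: (@ofR_inj R k); rewrite -sqnorm_adj sqnorm_trace adjmxK adjmxM adjmxK.
rewrite -mulmxA (mulmxA (adjmx A)) Aorth mul1mx trace_mx11 mxE rmorphM !rmorph1 mulr1.
rewrite (bigD1 i)//= big1 ?addr0.
  by rewrite !mxE eqxx mul1r rmorph1.
by move=> j ji; rewrite !mxE eq_sym (negPf ji) mul0r.
Qed.

Lemma sum_slope_Re i :
  \sum_j \sum_b scalar_Re (slope i j b) ^+ 2 = sqnorm (row i blue) - 1.
Proof.
rewrite -sqnorm_row_blue_ortho /sqnorm big_ord1; apply: eq_bigr => j _.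
by rewrite -sum_Re_unit_dir mxE; apply: eq_bigr => b _; rewrite slopeE.
Qed.

Lemma sum_slope_modulus i :
  \sum_j \sum_b modulus (slope i j b) ^+ 2 = beta * (sqnorm (row i blue) - 1).
Proof.
rewrite -sqnorm_row_blue_ortho /sqnorm big_ord1 mulr_sumr; apply: eq_bigr => j _.
rewrite mxE -(@sum_modulus_unit_dir R k) mulr_suml; apply: eq_bigr => b _.
by rewrite slopeE modulusM exprMn mulrC.
Qed.

Lemma slope_le i j b : modulus (slope i j b) ^+ 2 <= sqnorm (row i blue).
Proof.
rewrite slopeE modulusM exprMn; apply: (@le_trans _ _ (sqnorm (row i (blue *m ortho_proj)))).
  apply: (@le_trans _ _ (modulus ((blue *m ortho_proj) i j) ^+ 2 * 1)).
    by rewrite ler_wpM2l ?sqr_ge0// expr_le1 ?modulus_ge0 ?modulus_unit_dir_le1.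
  have := modulus_entry_le (row i (blue *m ortho_proj)) 0 j.
  by rewrite mulr1 mxE.
by rewrite sqnorm_row_blue_ortho gerBl.
Qed.

Lemma sqnorm_direction_le1 j b : sqnorm (direction j b) <= 1.
Proof.
apply: (le_trans (is_proj_sqnorm_le _ ortho_proj_proj)).
rewrite sqnormZ.
have -> : sqnorm (delta_mx j 0 : 'cV[K]_n) = 1.
  apply: (@ofR_inj R k); rewrite -sqnorm_adj sqnorm_trace adjmxK adjmx_delta.
  by rewrite mul_delta_mx trace_mx11 mxE !eqxx (rmorph1 (@ofR R k)).
by rewrite mulr1 expr_le1 ?modulus_ge0 ?modulus_unit_dir_le1.
Qed.

Lemma sqnorm_schur_direction_le1 j b : sqnorm (schur_proj *m direction j b) <= 1.
Proof.
exact: le_trans (is_proj_sqnorm_le _ schur_proj_proj) (sqnorm_direction_le1 _ _).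
Qed.

Lemma modulus_det_update i j b (t : R) :
  modulus (\det (compress P (A + ofR t *: (direction j b *m delta_mx 0 i)))) =
  modulus (\det G) * (1 + 2 * t * scalar_Re (slope i j b)
    + t ^+ 2 * (modulus (slope i j b) ^+ 2
      + sqnorm (row i blue) * sqnorm (schur_proj *m direction j b))).
Proof.
rewrite det_compress_update// ?Pproj.1// modulusM; congr (_ * _).
set u := direction j b; rewrite -/schur_proj.
have -> : invmx G *m adjmx A *m P *m u = blue *m u by [].
rewrite -/(slope i j b) -sqnorm_row_blue.
have -> : (adjmx u *m schur_proj *m u) 0 0 = ofR (sqnorm (schur_proj *m u)).
  exact/is_proj_quad/schur_proj_proj.
rewrite -rmorphXn -!rmorphM modulus_one_add; first by ring.
by do 2?apply: mulr_ge0; rewrite ?sqr_ge0 ?sqnorm_ge0.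
Qed.

(** There is no linear term because the direction is orthogonal to the columns of [A]:
    orthonormality is lost only at second order. *)
Lemma modulus_det_gram_update i j b (t : R)
    (B := A + ofR t *: (direction j b *m delta_mx 0 i)) :
  modulus (\det (adjmx B *m B)) = 1 + t ^+ 2 * sqnorm (direction j b).
Proof.
have cE (M : 'M[K]_(n, r)) : adjmx M *m M = compress 1%:M M.
  by rewrite /compress mulmx1.
rewrite cE det_compress_update ?adjmx1 -?cE ?Aorth ?unitmx1//.
rewrite det1 mul1r invmx1 !mul1mx !mulmx1.
set u := direction j b.
have -> : adjmx A *m u = 0 by rewrite mulmxA adj_ortho_proj mul0mx.
have -> : (0 : 'M[K]_(r, 1)) i 0 = 0 by rewrite mxE.
rewrite rmorph0 -/ortho_proj [X in _ * X * _]mxE eqxx.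
have -> : (adjmx u *m ortho_proj *m u) 0 0 = ofR (sqnorm u).
  by rewrite (is_proj_quad u ortho_proj_proj) /u /direction mulmxA ortho_proj_proj.2.
rewrite -rmorphXn !(mulr0, addr0, mulr1) /= -rmorphM -(rmorph1 ofR) -rmorphD modulus_ofR.
by rewrite ger0_norm//; apply: addr_ge0 => //; apply: mulr_ge0; rewrite ?sqr_ge0 ?sqnorm_ge0.
Qed.

Lemma modulus_compress_le1 i j : modulus (G i j) <= 1.
Proof.
have -> : G = (adjmx A *m P) *m adjmx (adjmx A *m P).
  by rewrite adjmxM adjmxK Pproj.1 mulmxA -(mulmxA (adjmx A) P P) Pproj.2.
apply: modulus_gram_le => h.
rewrite row_mul -sqnorm_adj adjmxM Pproj.1.
apply: (le_trans (is_proj_sqnorm_le _ Pproj)); rewrite le_eqVlt; apply/orP; left.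
apply/eqP/(@ofR_inj R k); rewrite sqnorm_adj sqnorm_trace trace_mx11 rmorph1.
transitivity ((adjmx A *m A) h h); last by rewrite Aorth mxE eqxx.
by rewrite !mxE; apply: eq_bigr => a _; rewrite !mxE scalar_conjK.
Qed.

Lemma det_compress_neq0 : \det G != 0.
Proof. by rewrite -unitfE -unitmxE. Qed.

Lemma modulus_det_compress_le : modulus (\det G) <= r`!%:R.
Proof.
apply: (le_trans (modulus_det_le modulus_compress_le1)).
by rewrite expr1n mulr1.
Qed.

(** By Cramer's rule the product is the modulus of a principal cofactor of [G]. This cancellation of
    the singularity makes all later remainders uniform in the frame and in the sample. *)
Lemma modulus_det_blue_le i : modulus (\det G) * sqnorm (row i blue) <= r`!%:R.
Proof.
have -> : sqnorm (row i blue) = modulus (invmx G i i).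
  by rewrite -sqnorm_row_blue modulus_ofR ger0_norm ?sqnorm_ge0.
rewrite -modulusM /invmx uG mxE mulrA divff ?det_compress_neq0// mul1r mxE.
rewrite /cofactor modulusM modulusX.
rewrite (_ : modulus (-1) = 1); last first.
  by rewrite -(rmorph1 ofR) -rmorphN modulus_ofR normrN normr1.
rewrite expr1n mul1r.
have h1 a b : modulus ((row' i (col' i G)) a b) <= 1.
  by rewrite mxE [X in modulus X]mxE modulus_compress_le1.
apply: (le_trans (modulus_det_le h1)); rewrite expr1n mulr1 ler_nat.
by rewrite leq_fact // leq_pred.
Qed.

Lemma sqnorm_blue_rows : sqnorm blue = \sum_i sqnorm (row i blue).
Proof.
by apply: eq_bigr => i _; rewrite /sqnorm big_ord1; apply: eq_bigr => j _; rewrite [in RHS]mxE.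
Qed.

(** The determinant of [G^-1] is at most [r!] times the [r]-th power of its trace; so a nearly
    degenerate [G] is paid for by a large [tr G^-1]. *)
Lemma inv_modulus_det_le : (modulus (\det G))^-1 <= r`!%:R * sqnorm blue ^+ r.
Proof.
rewrite -modulusV -det_inv -blue_adj; apply: modulus_det_le => i j.
apply: modulus_gram_le => {}i.
rewrite sqnorm_blue_rows (bigD1 i)//= lerDl.
by apply: sumr_ge0 => ? _; exact: sqnorm_ge0.
Qed.

End LocalGeometry.

(** * A polynomial logarithm *)

Section PolynomialBounds.
Context {R : realType}.
Implicit Type p : {poly R}.

Lemma poly_bounded p (M : R) :
  exists2 C : R, 0 <= C & forall x : R, `|x| <= M -> `|p.[x]| <= C.
Proof.
elim/poly_ind: p => [|p c [C C0 IH]].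
  by exists 0 => // x _; rewrite horner0 normr0.
exists (C * `|M| + `|c|); first by rewrite addr_ge0 ?mulr_ge0.
move=> x xM; rewrite hornerMXaddC (le_trans (ler_normD _ _))// lerD2r normrM.
by apply: ler_pM => //; [exact: IH|rewrite (le_trans xM)// ler_norm].
Qed.

(** Induction on [p]: passing from [p] to [p * 'X + c] multiplies the remainder by [x + h] and adds
    [p''(x) / 2 * h ^+ 3]. *)
Lemma poly_taylor2 p (M : R) : exists2 C : R, 0 <= C &
  forall x h : R, `|x| <= M -> `|h| <= M ->
  `|p.[x + h] - p.[x] - p^`().[x] * h - p^`()^`().[x] * h ^+ 2 / 2| <= C * `|h| ^+ 3.
Proof.
elim/poly_ind: p => [|p c [C C0 IH]].
  by exists 0 => // x h _ _; rewrite !deriv0 !horner0 !(mul0r, subr0) normr0.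
have [B B0 pB] := poly_bounded p^`()^`() M.
exists (C * (`|M| + `|M|) + B); first by rewrite !(addr_ge0, mulr_ge0).
move=> x h xM hM.
have dE : (p * 'X + c%:P)^`() = p^`() * 'X + p.
  by rewrite derivD derivC addr0 derivM derivX mulr1.
have ddE : (p * 'X + c%:P)^`()^`() = p^`()^`() * 'X + p^`() *+ 2.
  by rewrite dE derivD derivM derivX mulr1 -addrA mulr2n.
rewrite ddE dE !(hornerD, hornerM, hornerX, hornerC, hornerMn).
have IHr : `|p.[x + h] - p.[x] - p^`().[x] * h - p^`()^`().[x] * h ^+ 2 / 2|
    <= C * `|h| ^+ 3 by exact: IH.
set d := p.[x + h] - p.[x] - _ - _ in IHr.
have -> : p.[x + h] * (x + h) + c - (p.[x] * x + c) -
   (p^`().[x] * x + p.[x]) * h - (p^`()^`().[x] * x + p^`().[x] *+ 2) * h ^+ 2 / 2 =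
   d * (x + h) + p^`()^`().[x] / 2 * h ^+ 3.
  by rewrite /d; field.
rewrite (le_trans (ler_normD _ _))// [leRHS]mulrDl lerD//.
  rewrite normrM mulrAC ler_pM//.
  by rewrite (le_trans (ler_normD _ _))// lerD// (le_trans _ (ler_norm M)).
rewrite normrM normrX normrM normfV (ger0_norm (_ : 0 <= 2))//.
rewrite ler_wpM2r ?exprn_ge0// ler_pdivrMr//.
by rewrite (le_trans (pB _ xM))// ler_peMr// ler1n.
Qed.

(** In the application [x] is the volume ratio, [z] is [x] times the real part of the slope, [v] is
    [x] times the coefficient of [t ^+ 2] in [modulus_det_update], and [c] is the squared norm of
    the direction. The two quotients are then the ratios at the frames moved by [e] and [- e]. The
    constant [C] must serve down to [x = 0]. *)
Definition second_difference_bound p (C : R) : Prop :=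
  forall e x z v c : R, 0 < e -> e <= 1 -> 0 <= x -> x <= 1 -> `|z| <= 1 ->
    0 <= v -> v <= 2 -> 0 <= c -> c <= 1 ->
  p.[(x + 2 * e * z + e ^+ 2 * v) / (1 + e ^+ 2 * c)]
    + p.[(x - 2 * e * z + e ^+ 2 * v) / (1 + e ^+ 2 * c)] - 2 * p.[x]
  <= e ^+ 2 * (2 * p^`().[x] * (v - x * c) + 4 * p^`()^`().[x] * z ^+ 2) + C * e ^+ 3.

Lemma poly_second_difference p : exists2 C : R, 0 <= C & second_difference_bound p C.
Proof.
have [B1 B10 pB1] := poly_bounded p^`() 4.
have [B2 B20 pB2] := poly_bounded p^`()^`() 4.
have [C C0 pC] := poly_taylor2 p 4.
(* The summands pay, in turn, for dropping the denominator [D] in the first-order term ([E1]), for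
   dropping [D] and the square of [e ^+ 2 * w] in the second-order term ([E2]), and for two Taylor
   remainders [C * (4 * e) ^+ 3]. *)
exists (B1 * 4 + B2 * 12 + C * 128).
  by rewrite !addr_ge0// mulr_ge0.
move=> e x z v c e0 e1 x0 x1 zn v0 v2 c0 c1.
set D := 1 + e ^+ 2 * c.
have e2 : 0 < e ^+ 2 by rewrite exprn_gt0.
have D1 : 1 <= D by rewrite lerDl mulr_ge0// ltW.
have D0 : 0 < D by exact: lt_le_trans ltr01 D1.
set w := v - x * c.
have w2 : `|w| <= 2 by rewrite ler_norml /w; apply/andP; split; nra.
pose h (s : R) := (s * (2 * e * z) + e ^+ 2 * w) / D.
have hE s : (x + s * (2 * e * z) + e ^+ 2 * v) / D = x + h s.
  by rewrite /h /w /D; field; rewrite -/D gt_eqF.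
have := hE 1; have := hE (-1); rewrite !mul1r !mulN1r => -> ->.
have xB : `|x| <= 4 by rewrite ger0_norm//; lra.
have hB s : `|s| <= 1 -> `|h s| <= 4 * e.
  move=> s1; rewrite /h normrM normfV (ger0_norm (ltW D0)) ler_pdivrMr//.
  apply: (@le_trans _ _ (4 * e * 1)); last by rewrite ler_wpM2l// mulr_ge0// ltW.
  rewrite mulr1 (le_trans (ler_normD _ _))// !normrM !(ger0_norm (ltW e0)) (ger0_norm (ler0n _ 2)).
  have : `|s| * (2 * e * `|z|) <= 2 * e.
    rewrite -[leRHS]mul1r ler_pM//; first by rewrite mulr_ge0// mulr_ge0// ltW.
    by rewrite ler_piMr ?mulr_ge0 ?(ltW e0).
  have : e * e * `|w| <= e * 2.
    by rewrite ler_pM// ?mulr_ge0 ?(ltW e0)// ler_piMr// ltW.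
  lra.
have tay s : `|s| <= 1 ->
    p.[x + h s] <= p.[x] + p^`().[x] * h s + p^`()^`().[x] * h s ^+ 2 / 2 + C * (64 * e ^+ 3).
  move=> s1; have hs := hB _ s1.
  have h4 : `|h s| <= 4 by rewrite (le_trans hs)// ler_piMr.
  have := pC _ _ xB h4; rewrite ler_norml => /andP[_].
  have : C * `|h s| ^+ 3 <= C * (64 * e ^+ 3).
    rewrite ler_wpM2l// (_ : 64 * e ^+ 3 = (4 * e) ^+ 3); last by ring.
    by rewrite lerXn2r// ?nnegrE// mulr_ge0// ltW.
  lra.
have t1 := tay 1; have t2 := tay (-1); rewrite normrN normr1 lexx in t1 t2.
have {}t1 := t1 isT; have {}t2 := t2 isT.
have DV : 0 < D^-1 by rewrite invr_gt0.
have DV1 : D^-1 <= 1 by rewrite invf_le1.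
have DVe : 1 - D^-1 <= e ^+ 2.
  rewrite lerBlDr -lerBlDl -[D^-1]mul1r ler_pdivlMr// /D.
  move: (e ^+ 2) e2 => E E0; have := mulr_ge0 (mulr_ge0 (ltW E0) (ltW E0)) c0; nra.
have s1 : h 1 + h (-1) = 2 * e ^+ 2 * w * D^-1 by rewrite /h; ring.
have s2 : h 1 ^+ 2 + h (-1) ^+ 2 =
    (8 * e ^+ 2 * z ^+ 2 + 2 * e ^+ 4 * w ^+ 2) * D^-1 ^+ 2 by rewrite /h; ring.
have e43 : e ^+ 4 <= e ^+ 3 by rewrite exprS ler_piMl// exprn_ge0// ltW.
have e40 : 0 <= e ^+ 4 by rewrite exprn_ge0// ltW.
have E1 : p^`().[x] * (h 1 + h (-1)) <= e ^+ 2 * (2 * p^`().[x] * w) + B1 * (4 * e ^+ 3).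
  rewrite s1 -lerBlDl.
  have -> : p^`().[x] * (2 * e ^+ 2 * w / D) - e ^+ 2 * (2 * p^`().[x] * w) =
    p^`().[x] * (- (2 * e ^+ 2 * w * (1 - D^-1))) by ring.
  apply: (le_trans (ler_norm _)); rewrite normrM ler_pM ?pB1//.
  have -> : 2 * e ^+ 2 * w * (1 - D^-1) = 2 * e ^+ 2 * (1 - D^-1) * w by ring.
  have nn : 0 <= 2 * e ^+ 2 * (1 - D^-1) by rewrite mulr_ge0 ?subr_ge0// mulr_ge0// ltW.
  rewrite normrN normrM (ger0_norm nn).
  apply: (@le_trans _ _ (2 * e ^+ 2 * e ^+ 2 * 2)).
    by rewrite ler_pM// ler_wpM2l// mulr_ge0// ltW.
  have -> : 2 * e ^+ 2 * e ^+ 2 * 2 = 4 * e ^+ 4 by ring.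
  by rewrite ler_wpM2l.
have E2 : p^`()^`().[x] * (h 1 ^+ 2 + h (-1) ^+ 2) / 2 <=
    e ^+ 2 * (4 * p^`()^`().[x] * z ^+ 2) + B2 * (12 * e ^+ 3).
  rewrite s2 -lerBlDl.
  have -> : p^`()^`().[x] * ((8 * e ^+ 2 * z ^+ 2 + 2 * e ^+ 4 * w ^+ 2) * D^-1 ^+ 2) / 2
      - e ^+ 2 * (4 * p^`()^`().[x] * z ^+ 2) =
    p^`()^`().[x] * (e ^+ 4 * w ^+ 2 * D^-1 ^+ 2
       - 4 * e ^+ 2 * z ^+ 2 * (1 - D^-1) * (1 + D^-1)).
    by field; rewrite gt_eqF.
  apply: (le_trans (ler_norm _)); rewrite normrM ler_pM ?pB2//.
  have D21 : 0 <= D^-1 ^+ 2 <= 1.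
    by rewrite exprn_ge0 ?(ltW DV)//= expr_le1// ltW.
  have w4 : w ^+ 2 <= 4.
    by rewrite -real_normK ?num_real// (_ : 4 = 2 ^+ 2) ?lerXn2r ?nnegrE//; ring.
  have z21 : z ^+ 2 <= 1.
    by rewrite -real_normK ?num_real// expr_le1.
  have a1 : 0 <= e ^+ 4 * w ^+ 2 * D^-1 ^+ 2 <= 4 * e ^+ 4.
    have w20 := sqr_ge0 w; move: D21 => /andP[? ?].
    have : 0 <= w ^+ 2 * D^-1 ^+ 2 <= 4 by apply/andP; split; nra.
    by move=> /andP[? ?]; apply/andP; split; nra.
  have a2 : 0 <= 4 * e ^+ 2 * z ^+ 2 * (1 - D^-1) * (1 + D^-1) <= 8 * e ^+ 4.
    have z20 := sqr_ge0 z; have DV1' : 0 <= 1 - D^-1 by rewrite subr_ge0.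
    have b1 : 0 <= (1 - D^-1) * (1 + D^-1) <= 2 * e ^+ 2 by apply/andP; split; nra.
    have b2 : 0 <= z ^+ 2 * ((1 - D^-1) * (1 + D^-1)) <= 2 * e ^+ 2.
      by move: b1 => /andP[? ?]; apply/andP; split; nra.
    move: b2 => /andP[b3 b4].
    have -> : 4 * e ^+ 2 * z ^+ 2 * (1 - D^-1) * (1 + D^-1) =
      4 * (e ^+ 2 * (z ^+ 2 * ((1 - D^-1) * (1 + D^-1)))) by ring.
    have -> : 8 * e ^+ 4 = 4 * (e ^+ 2 * (2 * e ^+ 2)) by ring.
    apply/andP; split; first by apply: mulr_ge0 => //; apply: mulr_ge0 => //; exact: ltW.
    by apply: ler_wpM2l => //; apply: ler_wpM2l => //; exact: ltW.
  rewrite ler_norml; move: a1 a2 => /andP[? ?] /andP[? ?].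
  by apply/andP; split; lra.
rewrite mulrDr; lra.
Qed.

Lemma harmonic_unbounded (H : R) :
  exists T, H <= \sum_(t < T) t.+1%:R^-1.
Proof.
apply: contrapT => /forallNP nH; apply: (@dvg_harmonic R).
apply: nondecreasing_is_cvgn.
  by apply: nondecreasing_series => i _ _; rewrite /harmonic /= invr_ge0.
exists H => _ [m _ <-]; rewrite /series /= big_mkord ltW// ltNge.
by apply/negP; exact: nH.
Qed.

(* A polynomial substitute for [ln] on [0, 1]: the "slope" [x p'(x)] is close to
   [1] unless [x] is tiny, and it varies slowly on the logarithmic scale. *)
Lemma slow_log_poly (H : R) : 0 < H -> exists p : {poly R},
  forall x : R, 0 < x -> x <= 1 ->
  [/\ x * p^`().[x] <= 1, 0 <= x * p^`().[x], 1 - x * p^`().[x] <= (x * H)^-1,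
      0 <= x * p^`().[x] + x ^+ 2 * p^`()^`().[x]
    & x * p^`().[x] + x ^+ 2 * p^`()^`().[x] <= H^-1].
Proof.
move=> H0; have [T HT] := harmonic_unbounded H.
set S := \sum_(t < T) _ in HT.
have S0 : 0 < S by exact: lt_le_trans H0 HT.
pose Y : {poly R} := 1 - 'X.
(* [x q(x)] is the average of [1 - (1 - x) ^+ t.+1] with weights proportional to [t.+1%:R^-1].
   Differentiation cancels these weights, so [x (x q)'] sums as a geometric series to
   [S^-1 * (1 - (1 - x) ^+ T)]. This is at most [S^-1], and the divergence of the harmonic series
   makes [S] exceed [H]. *)
pose q := S^-1 *: \sum_(t < T) t.+1%:R^-1 *: \sum_(i < t.+1) Y ^+ i.
pose p := - (S^-1 *: \sum_(t < T) t.+1%:R^-1 *: \sum_(i < t.+1) i.+1%:R^-1 *: Y ^+ i.+1).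
have d1 : (1 : {poly R})^`() = 0 by exact: (derivC 1).
have dY : Y^`() = -1 by rewrite /Y derivB derivX d1 sub0r.
have dp : p^`() = q.
  rewrite /p derivN derivZ -scalerN; congr (_ *: _).
  rewrite raddf_sum /= -sumrN; apply: eq_bigr => t _; rewrite derivZ -scalerN; congr (_ *: _).
  rewrite raddf_sum /= -sumrN; apply: eq_bigr => i _.
  rewrite derivZ deriv_exp dY /= mulN1r mulNrn scalerN opprK.
  by rewrite -scalerMnr scalerMnl -[_^-1 *+ _]mulr_natr mulVf ?scale1r// pnatr_eq0.
have geo m : 'X * \sum_(i < m) Y ^+ i = 1 - Y ^+ m.
  by rewrite -[RHS]opprB subrX1 -mulNr opprB /Y subKr.
have Xq : 'X * q = S^-1 *: \sum_(t < T) t.+1%:R^-1 *: (1 - Y ^+ t.+1).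
  rewrite /q -scalerAr mulr_sumr; congr (_ *: _); apply: eq_bigr => t _.
  by rewrite -scalerAr geo.
have dXq : ('X * q)^`() = S^-1 *: \sum_(t < T) Y ^+ t.
  rewrite Xq derivZ raddf_sum /=; congr (_ *: _); apply: eq_bigr => t _.
  rewrite derivZ derivB deriv_exp dY d1 sub0r /= mulN1r mulNrn opprK.
  by rewrite -scalerMnr scalerMnl -[_^-1 *+ _]mulr_natr mulVf ?scale1r// pnatr_eq0.
have XdXq : 'X * q + 'X ^+ 2 * q^`() = S^-1 *: (1 - Y ^+ T).
  by rewrite -geo scalerAr -dXq derivM derivX mul1r mulrDr mulrA -expr2.
exists p => x x0 x1; rewrite dp.
have y0 : 0 <= 1 - x by rewrite subr_ge0.
have y1 : 1 - x <= 1 by rewrite gerBl ltW.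
have YE : Y.[x] = 1 - x by rewrite !hornerE.
have kE : x * q.[x] = 1 - S^-1 * \sum_(t < T) t.+1%:R^-1 * (1 - x) ^+ t.+1.
  transitivity ('X * q).[x]; first by rewrite !hornerE.
  rewrite Xq hornerZ horner_sum -[X in X - _](mulVf (lt0r_neq0 S0)) -mulrBr -sumrB.
  congr (_ * _); apply: eq_bigr => t _.
  by rewrite !hornerE ?horner_exp ?YE; ring.
have gE : x * q.[x] + x ^+ 2 * q^`().[x] = S^-1 * (1 - (1 - x) ^+ T).
  transitivity ('X * q + 'X ^+ 2 * q^`()).[x]; first by rewrite !hornerE.
  by rewrite XdXq !hornerE ?horner_exp ?YE.
have SV0 : 0 <= S^-1 by rewrite invr_ge0 ltW.
have SVH : S^-1 <= H^-1 by rewrite lef_pV2.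
have jle1 : \sum_(t < T) t.+1%:R^-1 * (1 - x) ^+ t.+1 <= S.
  apply: ler_sum => t _; rewrite ler_piMr ?invr_ge0// exprn_ile1//.
have jle2 : \sum_(t < T) t.+1%:R^-1 * (1 - x) ^+ t.+1 <= x^-1.
  apply: (@le_trans _ _ (\sum_(t < T) (1 - x) ^+ t)).
    apply: ler_sum => t _; rewrite exprS mulrA ler_piMl ?exprn_ge0//.
    by rewrite mulr_ile1// ?invr_ge0// invf_le1 ?ler1n ?ltr0n.
  rewrite -[leRHS]mul1r ler_pdivlMr// mulrC.
  have := subrX1 (1 - x) T; have -> : 1 - x - 1 = - x by ring.
  rewrite mulNr; have := exprn_ge0 T y0; lra.
have j0 : 0 <= \sum_(t < T) t.+1%:R^-1 * (1 - x) ^+ t.+1.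
  by apply: sumr_ge0 => t _; rewrite mulr_ge0 ?invr_ge0 ?exprn_ge0.
rewrite gE kE; split.
- by rewrite gerBl mulr_ge0.
- by rewrite subr_ge0 mulrC ler_pdivrMr// mul1r.
- by rewrite opprB addrC subrK invfM mulrC ler_pM.
- by rewrite mulr_ge0// subr_ge0 exprn_ile1.
- by rewrite -[leRHS]mulr1 ler_pM// ?subr_ge0 ?exprn_ile1// gerBl exprn_ge0.
Qed.

End PolynomialBounds.

(** * Orthonormal frames and volume ratios *)

Lemma det_block_schur (F : comUnitRingType) m n (Aul : 'M[F]_m) (Aur : 'M[F]_(m, n))
    (Adl : 'M[F]_(n, m)) (Adr : 'M[F]_n) : Adr \in unitmx ->
  \det (block_mx Aul Aur Adl Adr) = \det (Aul - Aur *m invmx Adr *m Adl) * \det Adr.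
Proof.
move=> u.
have E : block_mx Aul Aur Adl Adr *m block_mx 1%:M 0 (- (invmx Adr *m Adl)) 1%:M =
    block_mx (Aul - Aur *m invmx Adr *m Adl) Aur 0 Adr.
  rewrite mulmx_block !mulmx1 !mulmx0 !add0r !mulmxN !mulmxA mulmxV// mul1mx.
  by rewrite subrr.
have := congr1 determinant E.
by rewrite det_mulmx det_lblock det_ublock !det1 !mulr1.
Qed.

Section Frames.
Context {R : realType} {k : scalar_kind}.
Local Notation K := (scalar R k).

(** Gram-Schmidt on the first column, then on the projections of the others. The change of basis is
    recorded because volume ratios and genericity are transported from [A] to [A *m C]. *)
Lemma orthonormal_basis_of_injective n r (A : 'M[K]_(n, r)) :
  (forall v : 'cV[K]_r, A *m v = 0 -> v = 0) ->
  exists C : 'M[K]_r, adjmx (A *m C) *m (A *m C) = 1%:M.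
Proof.
elim: r A => [|r IH] A injA.
  by exists 0; apply/matrixP => -[].
move: A injA; rewrite -[r.+1]/(1 + r)%N => A.
rewrite -[A]hsubmxK; move: (lsubmx A) (rsubmx A) => a B injA.
pose s : R := Num.sqrt (sqnorm a).
have a0 : a != 0.
  apply/eqP => a0; have := injA (col_mx 1%:M 0).
  rewrite mul_row_col mulmx1 mulmx0 addr0 a0 => /(_ erefl)/(congr1 usubmx).
  by rewrite col_mxKu linear0 => /matrixP/(_ 0 0)/eqP; rewrite !mxE oner_eq0.
have s0 : 0 < s by rewrite sqrtr_gt0 lt_def sqnorm_eq0 a0 sqnorm_ge0.
pose c := (ofR s^-1) *: a.
have cc : adjmx c *m c = 1%:M.
  rewrite [LHS]mx11_scalar -trace_mx11 mxtrace_mulC -sqnorm_trace sqnormZ.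
  rewrite modulus_ofR -normrX ger0_norm ?sqr_ge0// exprVn sqr_sqrtr ?sqnorm_ge0//.
  by rewrite mulVf ?sqnorm_eq0// rmorph1.
pose B' := B - c *m (adjmx c *m B).
have cB' : adjmx c *m B' = 0 by rewrite mulmxBr !mulmxA cc mul1mx subrr.
have [v B'v|C CE] := IH B'.
  have := injA (col_mx (- (ofR s^-1 *: (adjmx c *m B *m v))) v).
  rewrite mul_row_col mulmxN -scalemxAr scalemxAl -/c.
  have -> : - (c *m (adjmx c *m B *m v)) + B *m v = B' *m v.
    by rewrite mulmxBl !mulmxA addrC.
  by move=> /(_ B'v)/(congr1 dsubmx); rewrite col_mxKd linear0.
exists (block_mx (ofR s^-1)%:M (- (ofR s^-1 *: (adjmx c *m B *m C))) 0 C).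
have -> : row_mx a B *m block_mx (ofR s^-1)%:M (- (ofR s^-1 *: (adjmx c *m B *m C))) 0 C
    = row_mx c (B' *m C).
  rewrite mul_row_block mulmx0 addr0 mul_mx_scalar; congr row_mx.
  rewrite mulmxN -scalemxAr scalemxAl -/c mulmxBl !mulmxA addrC//.
have -> : adjmx (row_mx c (B' *m C)) = col_mx (adjmx c) (adjmx (B' *m C)).
  by rewrite /adjmx tr_row_mx map_col_mx.
rewrite mul_col_row CE cc mulmxA cB' mul0mx (scalar_mx_block 1 r); congr block_mx.
by rewrite -[LHS]adjmxK adjmxM adjmxK mulmxA cB' mul0mx adjmx0.
Qed.

Lemma orthonormalize n r (A : 'M[K]_(n, r)) : adjmx A *m A \in unitmx ->
  exists2 C : 'M[K]_r, C \in unitmx & adjmx (A *m C) *m (A *m C) = 1%:M.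
Proof.
move=> uA; have [v Av|C CE] := @orthonormal_basis_of_injective n r A.
  by rewrite -[v]mul1mx -(mulVmx uA) -!mulmxA Av !mulmx0.
exists C => //; move: CE; rewrite mulmxA => /mulmx1_unit[//].
Qed.

(** Dividing by the Gram determinant makes this a function of the column space alone; dividing by
    [r!] brings it into [0, 1], where the polynomial logarithm is controlled. *)
Definition volratio n r (P : 'M[K]_n) (A : 'M[K]_(n, r)) : R :=
  modulus (\det (compress P A)) / (r`!%:R * modulus (\det (adjmx A *m A))).

Lemma compressM n r (P : 'M[K]_n) (A : 'M[K]_(n, r)) (C : 'M[K]_r) :
  \det (compress P (A *m C)) =
  scalar_conj (\det C) * \det C * \det (compress P A).
Proof.
rewrite /compress adjmxM.
have -> : adjmx C *m adjmx A *m P *m (A *m C) = adjmx C *m (adjmx A *m P *m A) *m C.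
  by rewrite !mulmxA.
by rewrite !det_mulmx /adjmx det_map_mx det_tr mulrAC.
Qed.

Lemma compress1 n r (A : 'M[K]_(n, r)) : compress 1%:M A = adjmx A *m A.
Proof. by rewrite /compress mulmx1. Qed.

Lemma volratioM n r (P : 'M[K]_n) (A : 'M[K]_(n, r)) (C : 'M[K]_r) :
  C \in unitmx -> volratio P (A *m C) = volratio P A.
Proof.
rewrite unitmxE unitfE => uC; rewrite /volratio -!compress1 !compressM !modulusM.
set m := modulus (scalar_conj _) * _.
have m0 : m != 0 by rewrite mulf_neq0 ?modulus_eq0 ?fmorph_eq0.
by rewrite mulrCA -mulf_div divff// mul1r.
Qed.

Lemma volratio_ge0 n r (P : 'M[K]_n) (A : 'M[K]_(n, r)) : 0 <= volratio P A.
Proof. by rewrite divr_ge0 ?mulr_ge0 ?modulus_ge0. Qed.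

Lemma volratio_le1 n r (P : 'M[K]_n) (A : 'M[K]_(n, r)) :
  is_proj P -> adjmx A *m A \in unitmx -> volratio P A <= 1.
Proof.
move=> Pp uA; have [C uC CE] := orthonormalize uA.
rewrite -(volratioM P A uC) /volratio CE det1 modulus1 mulr1 ler_pdivrMr ?ltr0n ?fact_gt0//.
by rewrite mul1r; exact: modulus_det_compress_le.
Qed.

Lemma compress_unit_gram n r (P : 'M[K]_n) (A : 'M[K]_(n, r)) :
  compress P A \in unitmx -> adjmx A *m A \in unitmx.
Proof.
move=> uG; have rA : row_free (adjmx A).
  rewrite /row_free eqn_leq rank_leq_row -{1}(mxrank_unit uG).
  by rewrite /compress -mulmxA mxrankM_maxl.
by have := row_free_gram rA; rewrite adjmxK.
Qed.

(** A point of the moment curve: a nonzero linear form evaluated along it is a nonzero polynomial in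
    [t], hence vanishes only finitely often. *)
Definition moment_col n (t : R) : 'cV[K]_n := \col_i ofR t ^+ i.

(** By the Schur complement, adding a column [a] multiplies the determinant by the squared norm of
    [S *m a], so degeneracy means [S *m a = 0]. As the squared norm of [S] is [l - r > 0], some row
    of [S] is nonzero, and its entries are the coefficients of [q]. *)
Lemma extension_poly n r (l : nat) (P : 'M[K]_n) (A : 'M[K]_(n, r)) :
  is_proj P -> \tr P = l%:R -> (r < l)%N -> compress P A \in unitmx ->
  exists2 q : {poly K}, q != 0 & (size q <= n)%N /\
    forall t : R, \det (compress P (row_mx (moment_col n t) A)) = 0 -> root q (ofR t).
Proof.
move=> Pp trP rl uG; set S := schur_proj P A.
have S0 : S != 0.
  rewrite -sqnorm_eq0 (sqnorm_schur_proj Pp uG trP) subr_eq0 eqr_nat.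
  by rewrite gtn_eqF.
have [i Si] : exists i, row i S != 0.
  apply/existsP; apply: contraNT S0 => /existsPn nS; apply/eqP/row_matrixP => i.
  by have := nS i; rewrite negbK => /eqP ->; rewrite row0.
exists (rVpoly (row i S)).
  by apply: contra Si => /eqP q0; apply/eqP/(can_inj rVpolyK); rewrite q0 linear0.
split; first exact: size_poly.
move=> t; set a := moment_col n t.
have -> : compress P (row_mx a A) = block_mx (adjmx a *m P *m a) (adjmx a *m P *m A)
    (adjmx A *m P *m a) (compress P A).
  by rewrite /compress /adjmx tr_row_mx map_col_mx mul_col_mx mul_col_row.
rewrite det_block_schur// => /eqP; rewrite mulf_eq0 (negPf (det_compress_neq0 _))//.
rewrite orbF det_mx11.
have -> : (adjmx a *m P *m a - adjmx a *m P *m A *m invmx (compress P A) *m (adjmx A *m P *m a))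
   = adjmx a *m S *m a.
  by rewrite /S /schur_proj mulmxBr mulmxBl !mulmxA.
rewrite (is_proj_quad _ (schur_proj_proj Pp uG)) fmorph_eq0 sqnorm_eq0 => /eqP Sa.
apply/rootP; transitivity ((row i S *m a) 0 0); last by rewrite -row_mul Sa !mxE.
rewrite horner_poly mxE; apply: eq_bigr => j _.
by rewrite valK mxE [X in _ = _ * X]mxE.
Qed.

End Frames.

(** * Measurability *)

Lemma measurable_inv (R : realType) : measurable_fun [set: R] (@GRing.inv R).
Proof.
rewrite -(setUv [set 0 : R]); apply/measurable_funU.
- exact: measurable_set1.
- by apply: measurableC; exact: measurable_set1.
split; first exact: measurable_fun_set1.
apply: open_continuous_measurable_fun.
  by apply: closed_openC; exact: closed_eq.
by move=> x /set_mem /eqP x0; exact: inv_continuous.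
Qed.

Section RandomMatrices.
Context {R : realType} {k : scalar_kind} {disp : measure_display}.
Context {T : measurableType disp}.
Local Notation K := (scalar R k).

Definition random_scalar (f : T -> K) : Prop :=
  measurable_fun setT (fun w => scalar_Re (f w)) /\
  measurable_fun setT (fun w => scalar_Im (f w)).

Lemma scalar_ReM (x y : K) :
  scalar_Re (x * y) = scalar_Re x * scalar_Re y - scalar_Im x * scalar_Im y.
Proof.
move: x y; rewrite /scalar_Re /scalar_Im; case: k => /= [x y|[a b] [c d] //].
by rewrite mulr0 subr0.
Qed.

Lemma scalar_ImM (x y : K) :
  scalar_Im (x * y) = scalar_Re x * scalar_Im y + scalar_Im x * scalar_Re y.
Proof.
move: x y; rewrite /scalar_Re /scalar_Im; case: k => /= [x y|[a b] [c d] //].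
by rewrite mulr0 mul0r addr0.
Qed.

Lemma scalar_ImD (x y : K) : scalar_Im (x + y) = scalar_Im x + scalar_Im y.
Proof.
by move: x y; rewrite /scalar_Im; case: k => /= [x y|[a b] [c d] //]; rewrite addr0.
Qed.

Lemma scalar_Im_conj (x : K) : scalar_Im (scalar_conj x) = - scalar_Im x.
Proof.
by move: x; rewrite /scalar_Im /scalar_conj; case: k => /= [x|[a b] //]; rewrite oppr0.
Qed.

Lemma scalar_Im_ofR (a : R) : scalar_Im (ofR a : K) = 0.
Proof. by rewrite /scalar_Im /ofR; case: k. Qed.

Lemma modulus_sqr (x : K) : modulus x ^+ 2 = scalar_Re x ^+ 2 + scalar_Im x ^+ 2.
Proof.
move: x; rewrite /modulus /scalar_Re /scalar_Im; case: k => /= [x|[a b] /=].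
  by rewrite expr0n addr0 real_normK ?num_real.
by rewrite sqr_sqrtr ?addr_ge0 ?sqr_ge0.
Qed.

Lemma random_scalar_cst (c : K) : random_scalar (fun=> c).
Proof. by split; exact: measurable_cst. Qed.

Lemma random_scalarD f g :
  random_scalar f -> random_scalar g -> random_scalar (fun w => f w + g w).
Proof.
move=> [fr fi] [gr gi]; split.
  by under eq_fun do rewrite raddfD; exact: measurable_funD.
by under eq_fun do rewrite scalar_ImD; exact: measurable_funD.
Qed.

Lemma random_scalarM f g :
  random_scalar f -> random_scalar g -> random_scalar (fun w => f w * g w).
Proof.
move=> [fr fi] [gr gi]; split.
  under eq_fun do rewrite scalar_ReM.
  by apply: measurable_funB; exact: measurable_funM.
under eq_fun do rewrite scalar_ImM.
by apply: measurable_funD; exact: measurable_funM.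
Qed.

Lemma random_scalar_conj f :
  random_scalar f -> random_scalar (fun w => scalar_conj (f w)).
Proof.
move=> [fr fi]; split; first by under eq_fun do rewrite scalar_Re_conj.
by under eq_fun do rewrite scalar_Im_conj; exact: measurable_funN.
Qed.

Lemma random_scalar_ofR (f : T -> R) :
  measurable_fun setT f -> random_scalar (fun w => ofR (f w)).
Proof.
move=> mf; split; first by under eq_fun do rewrite scalar_ReK.
by under eq_fun do rewrite scalar_Im_ofR; exact: measurable_cst.
Qed.

Lemma random_scalar_sqmodulus f :
  random_scalar f -> measurable_fun setT (fun w => modulus (f w) ^+ 2).
Proof.
move=> [fr fi]; under eq_fun do rewrite modulus_sqr.
by apply: measurable_funD; exact: measurable_funX.
Qed.

Lemma random_scalar_modulus f :
  random_scalar f -> measurable_fun setT (fun w => modulus (f w)).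
Proof.
move=> mf.
have -> : (fun w => modulus (f w)) = @Num.sqrt R \o (fun w => modulus (f w) ^+ 2).
  by apply/funext => w /=; rewrite sqrtr_sqr ger0_norm// modulus_ge0.
apply: measurableT_comp; last exact: random_scalar_sqmodulus.
by apply: continuous_measurable_fun; exact: sqrt_continuous.
Qed.

Lemma random_scalarV f : random_scalar f -> random_scalar (fun w => (f w)^-1).
Proof.
move=> mf.
have -> : (fun w => (f w)^-1) =
    (fun w => ofR ((modulus (f w) ^+ 2)^-1) * scalar_conj (f w)).
  apply/funext => w; have [->|f0] := eqVneq (f w) 0.
    by rewrite rmorph0 mulr0 invr0.
  rewrite (fmorphV (@ofR R k)) /= -mul_conj_modulus invfM -mulrA mulVf ?mulr1//.
  by rewrite fmorph_eq0.
apply: random_scalarM; last exact: random_scalar_conj.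
apply: random_scalar_ofR; apply: measurableT_comp; first exact: measurable_inv.
exact: random_scalar_sqmodulus.
Qed.

Lemma random_scalar_sum I (s : seq I) (Q : pred I) (f : I -> T -> K) :
  (forall i, random_scalar (f i)) ->
  random_scalar (fun w => \sum_(i <- s | Q i) f i w).
Proof.
move=> mf; elim: s => [|i s IH].
  by under eq_fun do rewrite big_nil; exact: random_scalar_cst.
under eq_fun do rewrite big_cons.
by case: (Q i) => //; exact: random_scalarD.
Qed.

Lemma random_scalar_prod I (s : seq I) (Q : pred I) (f : I -> T -> K) :
  (forall i, random_scalar (f i)) ->
  random_scalar (fun w => \prod_(i <- s | Q i) f i w).
Proof.
move=> mf; elim: s => [|i s IH].
  by under eq_fun do rewrite big_nil; exact: random_scalar_cst.
under eq_fun do rewrite big_cons.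
by case: (Q i) => //; exact: random_scalarM.
Qed.

Lemma random_matrixP m n (F : T -> 'M[K]_(m, n)) :
  random_matrix F <-> forall i j, random_scalar (fun w => F w i j).
Proof. by []. Qed.

Lemma random_matrix_cst m n (M : 'M[K]_(m, n)) : random_matrix (fun _ : T => M).
Proof. by move=> i j; exact: random_scalar_cst. Qed.

Lemma random_matrixM m n p (F : T -> 'M[K]_(m, n)) (G : T -> 'M[K]_(n, p)) :
  random_matrix F -> random_matrix G -> random_matrix (fun w => F w *m G w).
Proof.
move=> mF mG i j; apply: (_ : random_scalar (fun w => (F w *m G w) i j)).
under eq_fun do rewrite mxE.
by apply: random_scalar_sum => h; apply: random_scalarM; [exact: mF|exact: mG].
Qed.

Lemma random_matrixB m n (F G : T -> 'M[K]_(m, n)) :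
  random_matrix F -> random_matrix G -> random_matrix (fun w => F w - G w).
Proof.
move=> mF mG i j; apply: (_ : random_scalar (fun w => (F w - G w) i j)).
under eq_fun do rewrite !mxE -mulN1r.
apply: random_scalarD; first exact: mF.
by apply: random_scalarM; [exact: random_scalar_cst|exact: mG].
Qed.

Lemma random_matrix_adj m n (F : T -> 'M[K]_(m, n)) :
  random_matrix F -> random_matrix (fun w => adjmx (F w)).
Proof.
move=> mF i j; apply: (_ : random_scalar (fun w => adjmx (F w) i j)).
under eq_fun do rewrite !mxE.
by apply: random_scalar_conj; exact: mF.
Qed.

Lemma random_scalar_det n (F : T -> 'M[K]_n) :
  random_matrix F -> random_scalar (fun w => \det (F w)).
Proof.
move=> mF; apply: random_scalar_sum => s.
apply: random_scalarM; first exact: random_scalar_cst.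
by apply: random_scalar_prod => i; exact: mF.
Qed.

(* Agrees with [invmx] on invertible matrices, but the default value for
   singular ones is [0]. *)
Definition qinvmx n (M : 'M[K]_n) : 'M[K]_n := (\det M)^-1 *: \adj M.

Lemma qinvmxE n (M : 'M[K]_n) : M \in unitmx -> qinvmx M = invmx M.
Proof. by move=> uM; rewrite /invmx uM. Qed.

Lemma qinvmx_singular n (M : 'M[K]_n) : \det M = 0 -> qinvmx M = 0.
Proof. by move=> M0; rewrite /qinvmx M0 invr0 scale0r. Qed.

Lemma random_matrix_qinvmx n (F : T -> 'M[K]_n) :
  random_matrix F -> random_matrix (fun w => qinvmx (F w)).
Proof.
move=> mF i j; apply: (_ : random_scalar (fun w => qinvmx (F w) i j)).
under eq_fun do rewrite mxE.
apply: random_scalarM; first exact/random_scalarV/random_scalar_det.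
under eq_fun do rewrite mxE /cofactor.
apply: random_scalarM; first exact: random_scalar_cst.
apply: random_scalar_det => a b.
apply: (_ : random_scalar (fun w => row' j (col' i (F w)) a b)).
by under eq_fun do rewrite !mxE; exact: mF.
Qed.

Lemma random_matrix_sqnorm m n (F : T -> 'M[K]_(m, n)) :
  random_matrix F -> measurable_fun setT (fun w => sqnorm (F w)).
Proof.
move=> mF; apply: measurable_sum => i; apply: measurable_sum => j.
by apply: random_scalar_sqmodulus; exact: mF.
Qed.

Lemma measurable_random_scalar_eq0 f :
  random_scalar f -> measurable [set w | f w = 0].
Proof.
move=> mf.
have -> : [set w | f w = 0] = (fun w => modulus (f w)) @^-1` [set 0].
  by apply/seteqP; split => w /=; [move=> ->; rewrite modulus0|move/eqP; rewrite modulus_eq0 => /eqP].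
rewrite -[X in measurable X]setTI.
by apply: (random_scalar_modulus mf) => //; exact: measurable_set1.
Qed.

End RandomMatrices.

(** * Comparing expectations, and parameters whose bad event is null *)

Section Probability.
Context {R : realType} {disp : measure_display} {T : measurableType disp}.
Variable P : probability T R.

(** No measurability is required: the integral of a nonnegative function is a supremum over the
    simple functions below it. Hence the residual, which contains [pinv], can be compared with a
    measurable minorant. *)
Lemma expectation_ge0_le (X Y : T -> R) :
  (forall w, 0 <= X w) -> (forall w, X w <= Y w) -> ('E_P[X] <= 'E_P[Y])%E.
Proof.
move=> X0 XY; rewrite unlock.
have Y0 w : 0 <= Y w by exact: le_trans (X0 w) (XY w).
rewrite !ge0_integralTE; [|by move=> w; rewrite lee_fin..].
apply: le_ereal_sup => _ [h hX <-]; exists h => // w.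
by rewrite (le_trans (hX w))// lee_fin.
Qed.

(** Double counting: a sample in [F] lies in at most [N] of the events, so the probabilities of
    finitely many events sum to at most [N]. If all events with [t] in the interval had positive
    probability, uncountability would give infinitely many of probability above a common positive
    level. *)
Lemma exists_avoiding_level (B : R -> set T) (F : set T) (N : nat) (a b : R) :
  a < b -> (forall t, measurable (B t)) -> measurable F -> P (~` F) = 0 ->
  (forall w, F w -> forall s : seq R, uniq s ->
     (forall t, t \in s -> B t w) -> (size s <= N)%N) ->
  exists2 t, a < t < b & P (B t) = 0.
Proof.
move=> ab mB mF PF BN; apply: contrapT => /forall2NP nt.
have BF0 t : P (B t `&` F) = 0 -> P (B t) = 0.
  move=> B0; apply/eqP; rewrite -measure_le0.
  have mI := measurableI _ _ (mB t) mF; have mC := measurableC mF.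
  apply: (@le_trans _ _ (P ((B t `&` F) `|` ~` F))).
    apply: le_measure; rewrite ?inE//; first exact: measurableU.
    by move=> w Bw; have [Fw|nFw] := pselect (F w); [left|right].
  apply: (le_trans (measureU2 _ mI mC)).
  by rewrite [X in (X + _)%E]B0 [X in (_ + X)%E]PF adde0.
pose S (m : nat) := [set t | a < t < b /\ (m.+1%:R^-1%:E <= P (B t `&` F))%E].
have cov : `]a, b[%classic `<=` \bigcup_m S m.
  move=> t; rewrite /= in_itv /= => tab.
  have Pt : (P (B t `&` F) != 0)%E.
    by apply/eqP => /BF0 B0; case: (nt t).
  have : (0 < P (B t `&` F))%E by rewrite lt0e Pt measure_ge0.
  have mI : measurable (B t `&` F) by exact: measurableI.
  rewrite -(fineK (fin_num_measure P _ mI)) lte_fin => P0.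
  have [m _ hm] := @near_infty_natSinv_lt R (PosNum P0).
  exists m => //; split => //.
  rewrite -[leRHS](fineK (fin_num_measure P _ mI)) lee_fin; apply: ltW; exact: (hm m (leqnn m)).
have [m infS] : exists m, infinite_set (S m).
  apply: contrapT => /forallNP finS.
  have cS : countable (\bigcup_m S m).
    apply: bigcup_countable => // m _; apply: finite_set_countable.
    exact: contrapT (finS m).
  have : countable `]a, b[%classic by exact: sub_countable (subset_card_le cov) cS.
  move/countable_lebesgue_measure0; rewrite lebesgue_measure_itv /= lte_fin ab.
  by move/eqP; rewrite -EFinB eqe subr_eq0 gt_eqF.
(* With this many levels, each of probability at least [m.+1%:R^-1], the total is at least [N + 1],
   against the upper bound [N]. *)
have [X XS Xcard] := infinite_set_fset (m.+1 * N.+1) infS.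
have mI t : measurable (B t `&` F) by exact: measurableI.
have le1 : (\sum_(t <- finmap.enum_fset X) P (B t `&` F) <= N%:R%:E)%E.
  rewrite (eq_bigr (fun t => \int[P]_w (\1_(B t `&` F) w)%:E)%E); last first.
    by move=> t _; rewrite integral_indic// setIT.
  rewrite -ge0_integral_sum//; last first.
    by move=> t; exact/measurable_EFinP/measurable_indic.
  apply: (@le_trans _ _ (\int[P]_w (N%:R%:E))%E); last first.
    by rewrite integral_cst// [X in (_ * X)%E]probability_setT mule1.
  apply: ge0_le_integral => //.
  - by move=> w _; apply: sume_ge0 => t _; rewrite lee_fin.
  - by apply: emeasurable_sum => t; exact/measurable_EFinP/measurable_indic.
  move=> w _; rewrite sumEFin lee_fin.
  under eq_bigr => t _ do rewrite indicE.
  have [Fw|nFw] := pselect (F w); last first.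
    by rewrite big1// => t _; rewrite memNset//= => -[].
  rewrite -natr_sum ler_nat.
  apply: (@leq_trans (size [seq t <- finmap.enum_fset X | w \in B t `&` F])).
    by rewrite size_filter -sum1_count [in leqRHS]big_mkcond; apply: leq_sum => t _ /=; case: (w \in _).
  apply: (BN w Fw); first by rewrite filter_uniq// finmap.fset_uniq.
  by move=> t; rewrite mem_filter => /andP[/set_mem[]].
have le2 : (((size (finmap.enum_fset X))%:R / m.+1%:R)%:E <= \sum_(t <- finmap.enum_fset X) P (B t `&` F))%E.
  apply: (@le_trans _ _ (\sum_(t <- finmap.enum_fset X) (m.+1%:R^-1)%:E)%E).
    by rewrite sumEFin big_const_seq count_predT iter_addr_0 mulr_natl.
  by rewrite big_seq [leRHS]big_seq; apply: lee_sum => t tX; case: (XS t tX).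
have := le_trans le2 le1; rewrite lee_fin ler_pdivrMr// -natrM ler_nat.
move=> /(leq_trans Xcard); rewrite mulnC leq_pmul2r//.
by rewrite ltnn.
Qed.

End Probability.

(** * The second-difference inequality *)

Section Superharmonicity.
Context {R : realType} {k : scalar_kind} (n r l : nat).
Local Notation K := (scalar R k).
Local Notation beta := (2 - (alphaK k)%:R : R).

Definition perturb (A : 'M[K]_(n, r)) (i : 'I_r) (j : 'I_n) (b : bool) (t : R) :=
  A + ofR t *: (direction A j b *m delta_mx 0 i).

Variables (P : 'M[K]_n) (A : 'M[K]_(n, r)).
Hypotheses (Pproj : is_proj P) (trP : \tr P = l%:R) (Aorth : adjmx A *m A = 1%:M).
Hypothesis uG : compress P A \in unitmx.

Let G := compress P A.
Let x := volratio P A.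
Let g i := sqnorm (row i (blue P A)).
Let y i j b := slope P A i j b.
Let q j b := sqnorm (schur_proj P A *m direction A j b).

Lemma volratio_orthE : x = modulus (\det G) / r`!%:R.
Proof. by rewrite /x /volratio Aorth det1 modulus1 mulr1. Qed.

Lemma volratio_orth_gt0 : 0 < x.
Proof.
by rewrite volratio_orthE divr_gt0 ?ltr0n ?fact_gt0// modulus_gt0 det_compress_neq0.
Qed.

Lemma volratio_orth_le1 : x <= 1.
Proof. by rewrite /x volratio_le1// Aorth unitmx1. Qed.

Lemma volratio_row_blue_le1 i : x * g i <= 1.
Proof.
rewrite volratio_orthE mulrAC ler_pdivrMr ?ltr0n ?fact_gt0// mul1r.
exact: modulus_det_blue_le.
Qed.

Lemma inv_volratio_le : x^-1 <= r`!%:R ^+ 2 * sqnorm (blue P A) ^+ r.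
Proof.
rewrite volratio_orthE invf_div expr2 -mulrA ler_wpM2l//.
exact: inv_modulus_det_le.
Qed.

Lemma volratio_perturb i j b t : volratio P (perturb A i j b t) =
  (x + 2 * t * (x * scalar_Re (y i j b))
     + t ^+ 2 * (x * (modulus (y i j b) ^+ 2 + g i * q j b)))
  / (1 + t ^+ 2 * sqnorm (direction A j b)).
Proof.
rewrite /volratio modulus_det_gram_update// modulus_det_update// volratio_orthE.
rewrite -/G -/(y i j b) -/(g i) -/(q j b); field.
rewrite pnatr_eq0 -lt0n fact_gt0 andbT gt_eqF//.
by rewrite ltr_pwDl// mulr_ge0 ?sqr_ge0 ?sqnorm_ge0.
Qed.

Lemma second_difference_le (p : {poly R}) (C e : R) i j b :
  second_difference_bound p C ->
  0 < e -> e <= 1 ->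
  p.[volratio P (perturb A i j b e)] + p.[volratio P (perturb A i j b (- e))] - 2 * p.[x] <=
  e ^+ 2 * (2 * (x * p^`().[x]) * (modulus (y i j b) ^+ 2 + g i * q j b
       - sqnorm (direction A j b))
     + 4 * (x ^+ 2 * p^`()^`().[x]) * scalar_Re (y i j b) ^+ 2) + C * e ^+ 3.
Proof.
move=> pC e0 e1; have x0 := ltW volratio_orth_gt0; have x1 := volratio_orth_le1.
have g0 : 0 <= g i by exact: sqnorm_ge0.
have q0 : 0 <= q j b by exact: sqnorm_ge0.
have q1 : q j b <= 1 by exact: sqnorm_schur_direction_le1.
have xg := volratio_row_blue_le1 i.
have yg : modulus (y i j b) ^+ 2 <= g i by exact: slope_le.
have y20 : 0 <= modulus (y i j b) ^+ 2 by exact: sqr_ge0.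
have yR : scalar_Re (y i j b) ^+ 2 <= modulus (y i j b) ^+ 2 by exact: scalar_Re_sqr_le.
have d1 : sqnorm (direction A j b) <= 1 by exact: sqnorm_direction_le1.
have d0 : 0 <= sqnorm (direction A j b) by exact: sqnorm_ge0.
have z1 : `|x * scalar_Re (y i j b)| <= 1.
  rewrite -(@expr_le1 _ 2)// real_normK ?num_real// exprMn.
  have : x * (x * scalar_Re (y i j b) ^+ 2) <= 1.
    apply: mulr_ile1 => //; first by rewrite mulr_ge0 ?sqr_ge0.
    by apply: le_trans xg; rewrite ler_wpM2l// (le_trans yR).
  by rewrite mulrA -expr2.
have xgq : 0 <= x * (g i * q j b) <= 1.
  apply/andP; split; first exact: mulr_ge0 x0 (mulr_ge0 g0 q0).
  by rewrite mulrA; apply: mulr_ile1 => //; exact: mulr_ge0 x0 g0.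
have xy : 0 <= x * modulus (y i j b) ^+ 2 <= 1.
  by rewrite mulr_ge0//= (le_trans _ xg)// ler_wpM2l.
move: xgq xy => /andP[a1 a2] /andP[a3 a4].
have := pC e x (x * scalar_Re (y i j b)) (x * (modulus (y i j b) ^+ 2 + g i * q j b))
  (sqnorm (direction A j b)) e0 e1 x0 x1 z1.
rewrite mulrDr; move=> /(_ _ _ d0 d1) H.
rewrite !volratio_perturb sqrrN mulrDr.
have -> : 2 * - e * (x * scalar_Re (y i j b)) = - (2 * e * (x * scalar_Re (y i j b))).
  by ring.
apply: (le_trans (H _ _)); [lra|lra|].
rewrite le_eqVlt; apply/orP; left; apply/eqP; ring.
Qed.

(** The discrete Laplacian. Summing the second-order terms over all directions gives
    [2 kx (a X - r b) + 4 ka (X - r)] with [kx = x p'] and [ka = x p' + x^2 p'']; for the logarithm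
    [kx = 1] and [ka = 0]. Since [2 = beta (1 + alpha)], [a] and [b] equal [beta (l - r - alpha)]
    and [beta (n - r - alpha)]; the [- 2] comes from the real parts of the slopes. *)
Lemma sum_second_difference_le (p : {poly R}) (C e H : R) :
  second_difference_bound p C ->
  0 < H -> x * p^`().[x] <= 1 -> 0 <= x * p^`().[x] + x ^+ 2 * p^`()^`().[x] ->
  x * p^`().[x] + x ^+ 2 * p^`()^`().[x] <= H^-1 ->
  0 < e -> e <= 1 ->
  let a := beta * (l%:R - r%:R + 1) - 2 in
  let b := beta * (n%:R - r%:R + 1) - 2 in
  let X := sqnorm (blue P A) in
  0 <= a ->
  \sum_i \sum_j \sum_b (p.[volratio P (perturb A i j b e)]
     + p.[volratio P (perturb A i j b (- e))] - 2 * p.[x]) <=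
  e ^+ 2 * ((2 * a + 4 / H) * X - 2 * (r%:R * b) + 2 * (r%:R * b) * (1 - x * p^`().[x]))
    + (r * (n * 2))%:R * C * e ^+ 3.
Proof.
move=> pC H0; set kx := x * p^`().[x]; set ka := kx + _ => k1 ka0 kaH e0 e1 a b X a0.
have step i : \sum_j \sum_b (p.[volratio P (perturb A i j b e)]
     + p.[volratio P (perturb A i j b (- e))] - 2 * p.[x]) <=
  e ^+ 2 * (2 * kx * (a * g i - b) + 4 * ka * (g i - 1)) + (n * 2)%:R * (C * e ^+ 3).
  apply: le_trans (ler_sum _ (fun j _ => ler_sum _ (fun b _ =>
     second_difference_le i j b pC e0 e1))) _.
  under eq_bigr do rewrite big_split /= -mulr_sumr sumr_const card_bool.
  rewrite big_split /= -mulr_sumr sumr_const card_ord -mulrnA [(n * 2)%:R * _]mulr_natl mulnC.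
  rewrite lerD2r ler_pM2l ?exprn_gt0//.
  under eq_bigr do rewrite big_split /= -!mulr_sumr.
  rewrite big_split /= -!mulr_sumr sum_slope_Re//.
  under eq_bigr do rewrite sumrB big_split /=.
  rewrite sumrB big_split /= sum_slope_modulus// sum_direction//.
  have -> : \sum_j \sum_b g i * q j b = g i * (beta * (l%:R - r%:R)).
    rewrite -(sum_schur_direction Pproj uG trP) mulr_sumr.
    by apply: eq_bigr => j _; rewrite mulr_sumr.
  rewrite -/(g i) le_eqVlt; apply/orP; left; apply/eqP.
  by rewrite /ka /a /b -/kx; ring.
clearbody a b; apply: le_trans (ler_sum _ (fun i _ => step i)) _.
rewrite big_split /= -mulr_sumr sumr_const card_ord.
have -> : (n * 2)%:R * (C * e ^+ 3) *+ r = (r * (n * 2))%:R * C * e ^+ 3.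
  by rewrite -[LHS]mulr_natl [(r * _)%:R]natrM !mulrA.
rewrite lerD2r.
rewrite ler_pM2l ?exprn_gt0//.
rewrite big_split /= -!mulr_sumr !sumrB -mulr_sumr !sumr_const card_ord.
have -> : \sum_i g i = X by rewrite /X sqnorm_blue_rows.
have X0 : 0 <= X by exact: sqnorm_ge0.
rewrite -[b *+ r]mulr_natl.
(* [kx] may be replaced by 1 in the nonnegative term [a X]; in the term [- r b] the defect [1 - kx]
   has to be kept. *)
have aX : 2 * kx * (a * X) <= 2 * (a * X) by rewrite ler_wpM2r ?mulr_ge0//; lra.
have kX : 4 * ka * (X - r%:R) <= 4 / H * X.
  apply: (@le_trans _ _ (4 * ka * X)); first by rewrite ler_wpM2l ?mulr_ge0// gerBl.
  by rewrite ler_wpM2r// ler_wpM2l.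
lra.
Qed.

(** Below the cutoff [Y] the ratio [x] is bounded away from 0 by [inv_volratio_le], so the defect is
    of order [1 / H]; above it the trivial bound 1 is at most [sqnorm (blue P A) / Y]. Both terms
    have a controlled mean. *)
Lemma slope_defect_le (p : {poly R}) (H Y : R) :
  0 < H -> 0 < Y -> 0 <= x * p^`().[x] -> 1 - x * p^`().[x] <= (x * H)^-1 ->
  1 - x * p^`().[x] <= r`!%:R ^+ 2 * Y ^+ r / H + sqnorm (blue P A) / Y.
Proof.
move=> H0 Y0 k0 kH; set X := sqnorm _.
have X0 : 0 <= X by exact: sqnorm_ge0.
have [XY|YX] := leP X Y.
  apply: (le_trans kH); rewrite invfM.
  apply: (@le_trans _ _ (r`!%:R ^+ 2 * Y ^+ r / H)).
    rewrite ler_wpM2r ?invr_ge0 ?(ltW H0)// (le_trans inv_volratio_le)//.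
    by rewrite ler_wpM2l ?sqr_ge0// lerXn2r// nnegrE// ltW.
  by rewrite lerDl divr_ge0// ltW.
apply: (@le_trans _ _ 1); first by rewrite gerBl.
apply: (@le_trans _ _ (X / Y)); first by rewrite ler_pdivlMr// mul1r ltW.
by rewrite lerDr divr_ge0 ?mulr_ge0 ?exprn_ge0 ?sqr_ge0// ltW.
Qed.

End Superharmonicity.

(** * Generic frames *)

Section Mean.
Context {R : realType} {disp : measure_display} {T : measurableType disp}.
Variable P : probability T R.
Implicit Types f g : T -> R.

Definition integrable_rv (f : T -> R) := P.-integrable setT (EFin \o f).
Definition mean (f : T -> R) : R := Rintegral P setT f.

Lemma integrable_rv_cst (c : R) : integrable_rv (fun=> c).
Proof. exact: finite_measure_integrable_cst. Qed.

Lemma integrable_rvD f g : integrable_rv f -> integrable_rv g ->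
  integrable_rv (fun w => f w + g w).
Proof. by move=> fi gi; have := integrableD measurableT fi gi. Qed.

Lemma integrable_rvB f g : integrable_rv f -> integrable_rv g ->
  integrable_rv (fun w => f w - g w).
Proof. by move=> fi gi; have := integrableB measurableT fi gi. Qed.

Lemma integrable_rvZ c f : integrable_rv f -> integrable_rv (fun w => c * f w).
Proof. by move=> fi; have := integrableZl measurableT c fi. Qed.

Lemma integrable_rv_sum I (s : seq I) (f : I -> T -> R) :
  (forall i, integrable_rv (f i)) -> integrable_rv (fun w => \sum_(i <- s) f i w).
Proof.
move=> fi; elim: s => [|i s IH].
  by under eq_fun do rewrite big_nil; exact: integrable_rv_cst.
by under eq_fun do rewrite big_cons; exact: integrable_rvD.
Qed.

Lemma integrable_rv_bounded f M : measurable_fun setT f ->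
  (forall w, `|f w| <= M) -> integrable_rv f.
Proof.
move=> mf fM; apply: measurable_bounded_integrable => //.
  by rewrite (le_lt_trans (probability_le1 _ _)) ?ltry.
exists M; split; first exact: num_real.
by move=> y My w _ /=; rewrite (le_trans (fM w))// ltW.
Qed.

Lemma mean_cst c : mean (fun=> c) = c.
Proof. by rewrite /mean Rintegral_cst// [X in fine X]probability_setT mulr1. Qed.

Lemma meanD f g : integrable_rv f -> integrable_rv g ->
  mean (fun w => f w + g w) = mean f + mean g.
Proof. exact: RintegralD. Qed.

Lemma meanB f g : integrable_rv f -> integrable_rv g ->
  mean (fun w => f w - g w) = mean f - mean g.
Proof. exact: RintegralB. Qed.

Lemma meanZ c f : integrable_rv f -> mean (fun w => c * f w) = c * mean f.
Proof. exact: RintegralZl. Qed.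

Lemma mean_sum I (s : seq I) (f : I -> T -> R) : (forall i, integrable_rv (f i)) ->
  mean (fun w => \sum_(i <- s) f i w) = \sum_(i <- s) mean (f i).
Proof.
move=> fi; elim: s => [|i s IH].
  by rewrite big_nil; under eq_fun do rewrite big_nil; rewrite mean_cst.
rewrite big_cons -IH; under eq_fun do rewrite big_cons.
by apply: meanD => //; exact: integrable_rv_sum.
Qed.

Lemma le_mean f g (N : set T) : measurable N -> P N = 0 ->
  integrable_rv f -> integrable_rv g ->
  (forall w, ~ N w -> f w <= g w) -> mean f <= mean g.
Proof.
move=> mN PN fi gi fg; rewrite /mean /Rintegral.
rewrite (negligible_integral mN measurableT fi PN).
rewrite (negligible_integral mN measurableT gi PN).
have mD : measurable (setT `\` N) by exact: measurableD.
apply: le_Rintegral => //.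
- exact: integrableS fi.
- exact: integrableS gi.
- by move=> w [_]; exact: fg.
Qed.

End Mean.

(** * Projections onto random ranges, and frames in general position *)

Section RandomProjection.
Context {R : realType} {k : scalar_kind} {n l : nat}.
Local Notation K := (scalar R k).

(* The orthogonal projection onto the column space of [M] when [M] has full
   column rank, and [0] otherwise. *)
Definition range_proj (M : 'M[K]_(n, l)) : 'M[K]_n :=
  M *m qinvmx (adjmx M *m M) *m adjmx M.

Lemma range_proj_eq0 (M : 'M[K]_(n, l)) :
  adjmx M *m M \notin unitmx -> range_proj M = 0.
Proof.
rewrite unitmxE unitfE negbK => /eqP d0.
by rewrite /range_proj qinvmx_singular// mulmx0 mul0mx.
Qed.

Lemma range_proj_proj (M : 'M[K]_(n, l)) : is_proj (range_proj M).
Proof.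
have [uM|nuM] := boolP (adjmx M *m M \in unitmx); last first.
  by rewrite range_proj_eq0//; split; rewrite ?adjmx0// mulmx0.
rewrite /range_proj qinvmxE//; split.
  by rewrite !adjmxM adjmxK adjmx_inv adjmxM adjmxK !mulmxA.
rewrite !mulmxA -(mulmxA _ (adjmx M) M) -(mulmxA _ (invmx _) (adjmx M *m M)).
by rewrite mulVmx// mulmx1.
Qed.

Lemma trace_range_proj (M : 'M[K]_(n, l)) :
  adjmx M *m M \in unitmx -> \tr (range_proj M) = l%:R.
Proof.
move=> uM; rewrite /range_proj qinvmxE// -mulmxA mxtrace_mulC -mulmxA.
by rewrite mulVmx// mxtrace1.
Qed.

Lemma full_rank_gram (M : 'M[K]_(n, l)) : \rank M = l -> adjmx M *m M \in unitmx.
Proof.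
move=> rM; have fM : row_free (adjmx M) by rewrite /row_free /adjmx mxrank_map mxrank_tr rM.
by have := row_free_gram fM; rewrite adjmxK.
Qed.

End RandomProjection.

Section GenericFrames.
Context {R : realType} {k : scalar_kind} {disp : measure_display}.
Context {T : measurableType disp} (P : probability T R) {n l : nat}.
Local Notation K := (scalar R k).
Variables (Om : T -> 'M[K]_(n, l)) (mOm : random_matrix Om).
Hypothesis fullOm : {ae P, forall w, \rank (Om w) = l}.

Local Notation Pi := (fun w => range_proj (Om w)).

Lemma random_matrix_range_proj : random_matrix Pi.
Proof.
apply: random_matrixM; last exact: random_matrix_adj.
apply: random_matrixM => //; apply: random_matrix_qinvmx.
by apply: random_matrixM => //; exact: random_matrix_adj.
Qed.

Definition regular_locus : set T := [set w | adjmx (Om w) *m Om w \in unitmx].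

Lemma regular_locusC :
  ~` regular_locus = [set w | \det (adjmx (Om w) *m Om w) = 0].
Proof.
apply/seteqP; split => w /=; rewrite /regular_locus /= unitmxE unitfE.
  by move=> /negP; rewrite negbK => /eqP.
by move=> ->; rewrite eqxx.
Qed.

Lemma measurable_regular_locus : measurable regular_locus.
Proof.
rewrite -[regular_locus]setCK regular_locusC; apply: measurableC.
apply: measurable_random_scalar_eq0; apply: random_scalar_det.
by apply: random_matrixM => //; exact: random_matrix_adj.
Qed.

Lemma regular_locus_full : P (~` regular_locus) = 0.
Proof.
have [N [mN PN subN]] := fullOm.
apply/eqP; rewrite -measure_le0 -PN le_measure ?inE//.
  exact/measurableC/measurable_regular_locus.
by move=> w /= nw; apply: subN => /= rw; apply: nw; exact: full_rank_gram.
Qed.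

(** For [r > 0] this contains every sample outside [regular_locus], where the projection is 0. For
    [r = 0] it is empty, because the empty determinant is 1; so [regular_locus] is carried along
    separately. *)
Definition degenerate r (A : 'M[K]_(n, r)) : set T :=
  [set w | \det (compress (range_proj (Om w)) A) = 0].

Definition generic r (A : 'M[K]_(n, r)) : Prop := P (degenerate A) = 0.

Lemma random_matrix_compress r (A : 'M[K]_(n, r)) :
  random_matrix (fun w => compress (range_proj (Om w)) A).
Proof.
apply: random_matrixM; last exact: random_matrix_cst.
by apply: random_matrixM; [exact: random_matrix_cst|exact: random_matrix_range_proj].
Qed.

Lemma measurable_degenerate r (A : 'M[K]_(n, r)) : measurable (degenerate A).
Proof.
by apply: measurable_random_scalar_eq0; apply: random_scalar_det; exact: random_matrix_compress.
Qed.

Lemma not_degenerate r (A : 'M[K]_(n, r)) w :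
  ~ degenerate A w -> compress (range_proj (Om w)) A \in unitmx.
Proof. by rewrite unitmxE unitfE => d; apply/eqP. Qed.

Lemma measure_setU0 (A B : set T) : measurable A -> measurable B ->
  P A = 0 -> P B = 0 -> P (A `|` B) = 0.
Proof.
move=> mA mB A0 B0; apply/eqP; rewrite -measure_le0.
apply: (le_trans (measureU2 _ mA mB)).
by rewrite [X in (X + _)%E]A0 [X in (_ + X)%E]B0 adde0.
Qed.

Lemma generic_gram r (A : 'M[K]_(n, r)) : generic A -> adjmx A *m A \in unitmx.
Proof.
move=> gA; have [w nw] : exists w, ~ degenerate A w.
  apply: contrapT => /forallNP dA.
  have : degenerate A = setT by apply/seteqP; split => // w _; exact: contrapT (dA w).
  move=> E; move: gA; rewrite /generic E probability_setT => /eqP.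
  by rewrite onee_eq0.
exact: compress_unit_gram (not_degenerate nw).
Qed.

(** Columns are added one at a time from the moment curve. For almost every sample fewer than [n]
    parameters [t] are bad, so some [t] is bad with probability 0. *)
Lemma generic_exists r : (r <= l)%N -> exists A : 'M[K]_(n, r), generic A.
Proof.
elim: r => [_|r IH rl].
  exists 0; rewrite /generic (_ : degenerate _ = set0) ?measure0//.
  apply/seteqP; split => // w; rewrite /degenerate /= det_mx00 => /eqP.
  by rewrite oner_eq0.
have [A gA] := IH (ltnW rl).
pose B t := degenerate (row_mx (moment_col n t) A : 'M[K]_(n, 1 + r)).
pose F := regular_locus `&` ~` degenerate A.
have mF : measurable F.
  by apply: measurableI; [exact: measurable_regular_locus|exact/measurableC/measurable_degenerate].
have PF : P (~` F) = 0.
  rewrite setCI setCK; apply: measure_setU0 => //.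
  - exact/measurableC/measurable_regular_locus.
  - exact: measurable_degenerate.
  - exact: regular_locus_full.
have [|t _ Bt] := @exists_avoiding_level R _ T P B F n 0 1 ltr01
  (fun t => measurable_degenerate _) mF PF; last first.
  by exists (row_mx (moment_col n t) A).
move=> w [rw nw] s us sB.
have [q q0 [sq rq]] := extension_poly (range_proj_proj (Om w))
  (trace_range_proj rw) rl (not_degenerate nw).
rewrite -(size_map (@ofR R k)); apply: leq_trans sq.
apply: ltnW; apply: max_poly_roots => //; last by rewrite map_inj_uniq//; exact: ofR_inj.
by apply/allP => _ /mapP[t ts ->]; apply: rq; exact: sB.
Qed.

Lemma genericM r (A : 'M[K]_(n, r)) (C : 'M[K]_r) :
  C \in unitmx -> generic A -> generic (A *m C).
Proof.
move=> uC; rewrite /generic => <-; congr (P _); apply/seteqP; split => w.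
  rewrite /degenerate /= compressM => /eqP; rewrite !mulf_eq0 fmorph_eq0 orbb.
  by move: uC; rewrite unitmxE unitfE => /negPf -> /eqP.
by rewrite /degenerate /= compressM => ->; rewrite mulr0.
Qed.

(** With [u] the signed step and [y] the slope, the determinant is multiplied by [(1 + u Re y)^2]
    plus a nonnegative term. It can vanish only if [1 + u Re y = 0], that is, for at most one [t]
    per perturbation. *)
Lemma generic_perturb r (A : 'M[K]_(n, r)) (a b : R) :
  adjmx A *m A = 1%:M -> generic A -> a < b ->
  exists2 t, a < t < b & forall i j c,
    generic (perturb A i j c t) /\ generic (perturb A i j c (- t)).
Proof.
move=> Aorth gA ab.
pose I := ('I_r * 'I_n * bool * bool)%type.
pose D (x : I) t := degenerate (perturb A x.1.1.1 x.1.1.2 x.1.2 ((-1) ^+ x.2 * t)).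
(* The product merges the finitely many perturbations into one event, so that a single [t] serves
   all directions and both signs. *)
pose B t := [set w | \prod_(x : I)
   \det (compress (range_proj (Om w)) (perturb A x.1.1.1 x.1.1.2 x.1.2 ((-1) ^+ x.2 * t))) = 0].
have mB t : measurable (B t).
  apply: measurable_random_scalar_eq0; apply: random_scalar_prod => x.
  by apply: random_scalar_det; exact: random_matrix_compress.
have DB x t : D x t `<=` B t.
  by move=> w Dw; rewrite /B /= (bigD1 x)//= [X in X * _]Dw mul0r.
have [||t tab Bt] := @exists_avoiding_level R _ T P B (~` degenerate A) #|{: I}| a b ab mB
  (measurableC (measurable_degenerate A)).
- by rewrite setCK.
- move=> w nw s us sB; have uG := not_degenerate nw.
  pose Q := range_proj (Om w); have Qp : is_proj Q := range_proj_proj (Om w).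
  pose z (x : I) : R := (-1) ^+ x.2 * scalar_Re (slope Q A x.1.1.1 x.1.1.2 x.1.2).
  pose q : {poly R} := \prod_(x : I) (1 + z x *: 'X).
  have q0 : q != 0.
    apply/eqP => /(congr1 (horner^~ 0)); rewrite horner0 horner_prod => /eqP.
    by rewrite big1 ?oner_eq0// => x _; rewrite !hornerE.
  have sq : (size q <= #|{: I}|.+1)%N.
    rewrite (leq_trans (size_prod_leq _ _))//.
    apply: (@leq_trans ((\sum_(x : I) 2).+1 - #|{: I}|)%N).
      apply: leq_sub2r; rewrite ltnS; apply: leq_sum => x _.
      rewrite (leq_trans (size_polyD _ _))// geq_max size_poly1 /=.
      by rewrite (leq_trans (size_scale_leq _ _))// size_polyX.
    by rewrite sum_nat_const muln2 -addnn subSn ?leq_addr// addnK.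
  rewrite -ltnS; apply: leq_trans sq.
  apply: max_poly_roots => //; apply/allP => t ts.
  have : \prod_(x : I) \det (compress Q (perturb A x.1.1.1 x.1.1.2 x.1.2 ((-1) ^+ x.2 * t))) == 0.
    by apply/eqP; exact: sB.
  rewrite prodf_seq_eq0 => /hasP[x _ /=] dx0.
  rewrite /root /q horner_prod prodf_seq_eq0; apply/hasP; exists x; rewrite ?mem_index_enum//=.
  move: dx0; rewrite -modulus_eq0 modulus_det_update// mulf_eq0 modulus_eq0.
  rewrite (negPf (det_compress_neq0 uG)) /= => /eqP.
  set y := slope _ _ _ _ _; set u := _ * t; set c := sqnorm _ * sqnorm _ => E.
  have c0 : 0 <= c by rewrite mulr_ge0 ?sqnorm_ge0.
  have yR := scalar_Re_sqr_le y.
  have {}E : (1 + u * scalar_Re y) ^+ 2 <= 0.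
    have h1 : 0 <= u ^+ 2 * (modulus y ^+ 2 - scalar_Re y ^+ 2 + c).
      by rewrite mulr_ge0 ?sqr_ge0// addr_ge0// subr_ge0.
    by rewrite -E; lra.
  have : (1 + u * scalar_Re y) ^+ 2 == 0 by rewrite eq_le E sqr_ge0.
  rewrite sqrf_eq0 !hornerE /z -/y; congr (_ == _); rewrite /u; ring.
exists t => // i j c; split; apply/eqP; rewrite -measure_le0 -Bt le_measure ?inE//.
- exact: measurable_degenerate.
- by have := DB (i, j, c, false) t; rewrite /D /= expr0 mul1r.
- exact: measurable_degenerate.
- by have := DB (i, j, c, true) t; rewrite /D /= expr1 mulN1r.
Qed.

End GenericFrames.

(** * Reduction to the mean of [tr G^-1] *)

(** The adjoint of [blue] is [Q A G^-1], and [L] and [blue] agree on [Q A]; so their difference is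
    orthogonal to [blue] and Pythagoras applies. *)
Lemma gauss_markov (R : realType) (k : scalar_kind) (n r : nat)
    (Q : 'M[scalar R k]_n) (A : 'M[scalar R k]_(n, r)) (L : 'M[scalar R k]_(r, n)) :
  is_proj Q -> compress Q A \in unitmx -> L *m Q = L -> L *m A = 1%:M ->
  sqnorm (blue Q A) <= sqnorm L.
Proof.
move=> Qp uG LQ LA.
have o : (L - blue Q A) *m adjmx (blue Q A) = 0.
  rewrite {2}/blue !adjmxM adjmxK (invmx_compress_herm A Qp) Qp.1 !mulmxA.
  by rewrite mulmxBl LQ (blue_proj _ Qp) mulmxBl LA (blueA uG) subrr mul0mx.
have := sqnormD_orth o; rewrite addrC subrK => ->.
by rewrite lerDl sqnorm_ge0.
Qed.

Section LeastSquares.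
Context {R : realType} {k : scalar_kind} {n l r : nat}.
Local Notation K := (scalar R k).

Lemma pinv_uniq m q (A : 'M[K]_(m, q)) X : penrose A X -> pinv A = X.
Proof. exact: penrose_uniq (pinvP A). Qed.

(** This carries the least-squares problem from an orthonormal frame with [r] columns to a rank-[r]
    matrix with [d] columns. *)
Lemma pinv_mul_coisometry m q s (G : 'M[K]_(m, q)) (E : 'M[K]_(q, s)) :
  E *m adjmx E = 1%:M -> pinv (G *m E) = adjmx E *m pinv G.
Proof.
move=> EE; have [h1 h2 h3 h4] := pinvP G; apply: pinv_uniq.
have GX : G *m E *m (adjmx E *m pinv G) = G *m pinv G.
  by rewrite !mulmxA -(mulmxA G) EE mulmx1.
split.
- by rewrite GX mulmxA h1.
- by rewrite -(mulmxA (adjmx E *m _)) GX -mulmxA (mulmxA (pinv G)) h2.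
- by rewrite GX h3.
- have -> : adjmx E *m pinv G *m (G *m E) = adjmx E *m (pinv G *m G) *m E.
    by rewrite !mulmxA.
  by rewrite (adjmxM _ E) (adjmxM (adjmx E)) h4 adjmxK mulmxA.
Qed.

Lemma pinv_injective m q (G : 'M[K]_(m, q)) : adjmx G *m G \in unitmx ->
  pinv G = invmx (adjmx G *m G) *m adjmx G.
Proof.
move=> u; apply: pinv_uniq; split.
- by rewrite -!mulmxA mulVmx// mulmx1.
- by rewrite -(mulmxA _ (adjmx G)) mulVmx// mul1mx.
- by rewrite !adjmxM adjmxK adjmx_inv !adjmxM adjmxK mulmxA.
- by rewrite -mulmxA mulVmx// adjmx1.
Qed.

Variables (M : 'M[K]_(n, l)) (A : 'M[K]_(n, r)).
Hypothesis Aorth : adjmx A *m A = 1%:M.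

Lemma pinv_orthonormal : pinv A = adjmx A.
Proof. by rewrite pinv_injective Aorth ?unitmx1// invmx1 mul1mx. Qed.

(* [A *m sketch_solver] is the oblique projection defining the sketched
   least-squares residual. *)
Definition sketch_solver : 'M[K]_(r, n) :=
  qinvmx (adjmx (adjmx M *m A) *m (adjmx M *m A)) *m adjmx (adjmx M *m A) *m adjmx M.

Let Q := range_proj M.
Hypothesis uM : adjmx M *m M \in unitmx.
Hypothesis uG : compress Q A \in unitmx.

Lemma sketch_gram_unit : adjmx (adjmx M *m A) *m (adjmx M *m A) \in unitmx.
Proof.
set G1 := adjmx M *m A.
have fG : row_free (adjmx G1).
  rewrite /row_free eqn_leq rank_leq_row -{1}(mxrank_unit uG) /compress /Q /range_proj.
  have -> : adjmx A *m (M *m qinvmx (adjmx M *m M) *m adjmx M) *m A =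
    adjmx G1 *m (qinvmx (adjmx M *m M) *m adjmx M *m A).
    by rewrite /G1 adjmxM adjmxK !mulmxA.
  exact: mxrankM_maxl.
by have := row_free_gram fG; rewrite adjmxK.
Qed.

Lemma sketch_solverE : sketch_solver = pinv (adjmx M *m A) *m adjmx M.
Proof. by rewrite /sketch_solver qinvmxE ?pinv_injective ?sketch_gram_unit. Qed.

Lemma sketch_solverA : sketch_solver *m A = 1%:M.
Proof.
rewrite /sketch_solver qinvmxE ?sketch_gram_unit// -(mulmxA _ _ A) -(mulmxA _ (adjmx _)).
exact: mulVmx sketch_gram_unit.
Qed.

Lemma sketch_solver_proj : sketch_solver *m Q = sketch_solver.
Proof.
rewrite /sketch_solver -(mulmxA _ (adjmx M) Q); congr (_ *m _).
by rewrite /Q /range_proj !mulmxA qinvmxE// mulmxV// mul1mx.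
Qed.

Lemma sqnorm_blue_le : sqnorm (blue Q A) <= sqnorm sketch_solver.
Proof.
apply: gauss_markov => //; first exact: range_proj_proj.
- exact: sketch_solver_proj.
- exact: sketch_solverA.
Qed.

(** Expand the trace: each cross term is [\tr (L *m A) = r], and orthonormality removes [A] from the
    quadratic term. *)
Lemma sqnorm_sketch_residual :
  sqnorm (1%:M - A *m sketch_solver) = n%:R - 2 * r%:R + sqnorm sketch_solver.
Proof.
set L := sketch_solver; apply: (@ofR_inj R k).
have trAL : \tr (A *m L) = r%:R by rewrite mxtrace_mulC sketch_solverA mxtrace1.
have trLA : \tr (adjmx (A *m L)) = r%:R.
  by rewrite /adjmx trace_map_mx mxtrace_tr trAL rmorph_nat.
rewrite sqnorm_trace adjmxB adjmx1 mulmxBl mul1mx mulmxBr mulmx1 !linearB /=.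
rewrite mxtrace1 trAL trLA adjmxM mulmxA -(mulmxA A L) mxtrace_mulC.
rewrite (mulmxA (adjmx A)) Aorth mul1mx -sqnorm_trace.
by rewrite rmorphD rmorphB rmorphM /= !rmorph_nat; ring.
Qed.

Lemma sketch_residualE d p (E : 'M[K]_(r, d)) (i : 'I_n) (j : 'I_p) :
  E *m adjmx E = 1%:M ->
  let B : 'M[K]_(n, p) := delta_mx i j in
  frobenius (B - A *m E *m pinv (adjmx M *m (A *m E)) *m (adjmx M *m B)) ^+ 2 =
  sqnorm (col i (1%:M - A *m sketch_solver)).
Proof.
move=> EE B; rewrite frobenius_sqr -(sqnorm_mulmx_delta _ i j) -/B.
congr sqnorm; rewrite mulmxBl mul1mx; congr (_ - _).
rewrite sketch_solverE [adjmx M *m (A *m E)]mulmxA pinv_mul_coisometry// !mulmxA.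
by rewrite -(mulmxA A E) EE mulmx1.
Qed.

Lemma exact_residualE d p (E : 'M[K]_(r, d)) (i : 'I_n) (j : 'I_p) :
  E *m adjmx E = 1%:M ->
  let B : 'M[K]_(n, p) := delta_mx i j in
  B - A *m E *m pinv (A *m E) *m B = ortho_proj A *m B.
Proof.
move=> EE B; rewrite pinv_mul_coisometry// pinv_orthonormal mulmxBl mul1mx.
by rewrite !mulmxA -(mulmxA A E) EE mulmx1.
Qed.

End LeastSquares.

Section RiskBound.
Context {R : realType} {k : scalar_kind} {disp : measure_display}.
Context {T : measurableType disp} (P : probability T R) {n l : nat}.
Local Notation K := (scalar R k).
Variables (Om : T -> 'M[K]_(n, l)) (mOm : random_matrix Om).
Hypothesis fullOm : {ae P, forall w, \rank (Om w) = l}.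

(** This is [tr G^-1] wherever [G] is invertible. The form with [qinvmx] is measurable on the whole
    space and takes the value 0 at singular samples. *)
Definition blue_risk r (A : 'M[K]_(n, r)) (w : T) : R :=
  sqnorm (qinvmx (compress (range_proj (Om w)) A) *m adjmx A *m range_proj (Om w)).

Lemma blue_riskE r (A : 'M[K]_(n, r)) w : ~ degenerate Om A w ->
  blue_risk A w = sqnorm (blue (range_proj (Om w)) A).
Proof. by move=> /not_degenerate uG; rewrite /blue_risk qinvmxE. Qed.

Lemma blue_risk_degenerate r (A : 'M[K]_(n, r)) w : degenerate Om A w -> blue_risk A w = 0.
Proof.
move=> d0; rewrite /blue_risk qinvmx_singular// !mul0mx.
by apply/eqP; rewrite sqnorm_eq0.
Qed.

Lemma blue_risk_irregular r (A : 'M[K]_(n, r)) w :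
  ~ regular_locus Om w -> blue_risk A w = 0.
Proof.
move=> /negP ir; rewrite /blue_risk range_proj_eq0// mulmx0.
by apply/eqP; rewrite sqnorm_eq0.
Qed.

Lemma measurable_blue_risk r (A : 'M[K]_(n, r)) : measurable_fun setT (blue_risk A).
Proof.
apply: random_matrix_sqnorm; apply: random_matrixM; last exact: random_matrix_range_proj.
apply: random_matrixM; last exact: random_matrix_cst.
by apply: random_matrix_qinvmx; exact: random_matrix_compress.
Qed.

Variables (r d p : nat) (d_ge : (r <= d)%N) (p_gt0 : (0 < p)%N) (s : R).
Hypothesis risk_le : forall (A : 'M[K]_(n, d)) (B : 'M[K]_(n, p)), \rank A = r ->
  B <> A *m pinv A *m B ->
  ('E_P [fun w => (frobenius (B - A *m pinv (adjmx (Om w) *m A)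
                                    *m (adjmx (Om w) *m B)) ^+ 2)%R]
   <= (s * frobenius (B - A *m pinv A *m B) ^+ 2)%:E)%E.

(** Add the risk bounds for [B = delta_mx i j0] over all [i]. The exact residuals sum to [n - r],
    and the sketched ones to at least [n - 2 r + tr G^-1]. *)
Lemma mean_blue_risk_le (A : 'M[K]_(n, r)) : adjmx A *m A = 1%:M -> generic P Om A ->
  integrable_rv P (blue_risk A) /\
  mean P (blue_risk A) <= s * (n%:R - r%:R) - n%:R + 2 * r%:R.
Proof.
move=> Aorth gA.
pose F := regular_locus Om `&` ~` degenerate Om A.
have mF : measurable F.
  by apply: measurableI; [exact: measurable_regular_locus|exact/measurableC/measurable_degenerate].
have PF : P (~` F) = 0.
  rewrite setCI setCK; apply: measure_setU0 => //.
  - exact/measurableC/measurable_regular_locus.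
  - exact: measurable_degenerate.
  - exact: regular_locus_full.
have uG w : F w -> compress (range_proj (Om w)) A \in unitmx by move=> [_ /not_degenerate].
(* Restricting to [F] gives a measurable minorant of the sketched residual: there [pinv] agrees with
   the formula in [sketch_solver]. *)
pose f i w : R := \1_F w * sqnorm (col i (1%:M - A *m sketch_solver (Om w) A)).
have mSk : random_matrix (fun w => sketch_solver (Om w) A).
  have mG : random_matrix (fun w => adjmx (Om w) *m A).
    by apply: random_matrixM; [exact: random_matrix_adj|exact: random_matrix_cst].
  have mG' := random_matrix_adj mG.
  apply: random_matrixM; last exact: random_matrix_adj.
  by apply: random_matrixM => //; apply: random_matrix_qinvmx; exact: random_matrixM.
have mf i : measurable_fun setT (f i).
  apply: measurable_funM; first exact: measurable_indic.
  apply: random_matrix_sqnorm => a b.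
  apply: (_ : random_scalar (fun w => col i (1%:M - A *m sketch_solver (Om w) A) a b)).
  under eq_fun do rewrite mxE.
  move: a i {b}; apply/random_matrixP; apply: random_matrixB; first exact: random_matrix_cst.
  by apply: random_matrixM => //; exact: random_matrix_cst.
have f0 i w : 0 <= f i w by rewrite mulr_ge0 ?sqnorm_ge0// indicE.
pose E : 'M[K]_(r, d) := pid_mx r.
have EE : E *m adjmx E = 1%:M.
  rewrite /adjmx tr_pid_mx map_pid_mx /E pid_mx_id//; exact: pid_mx_1.
have rAE : \rank (A *m E) = r.
  apply/eqP; rewrite eqn_leq (leq_trans (mxrankM_maxl _ _)) ?rank_leq_col//=.
  have : (\rank (adjmx A *m (A *m E) *m adjmx E) <= \rank (A *m E))%N.
    by rewrite (leq_trans (mxrankM_maxl _ _))// mxrankM_maxr.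
  by rewrite mulmxA Aorth mul1mx EE mxrank1.
pose j0 := Ordinal p_gt0.
have fle i : integrable_rv P (f i) /\ mean P (f i) <= s * sqnorm (col i (ortho_proj A)).
  (* If [e_i] lies in the range of [A], then [B] is excluded from the supremum; but the oblique
     projection fixes the range of [A], so the sketched residual vanishes too. *)
  have [z0|nz] := eqVneq (sqnorm (col i (ortho_proj A))) 0.
    have -> : f i = fun=> 0.
      apply/funext => w; rewrite /f indicE; case: (boolP (w \in F)) => [/set_mem Fw|_].
        have /eqP := z0; rewrite sqnorm_eq0 mul1r => /eqP c0.
        have e : delta_mx i 0 = A *m (adjmx A *m delta_mx i (0 : 'I_1)).
          apply/eqP; rewrite -subr_eq0 mulmxA -{1}[delta_mx _ _]mul1mx -mulmxBl.
          by rewrite -colE; apply/eqP.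
        have := sketch_solverA (uG w Fw); move: (sketch_solver (Om w) A) => L LA.
        apply/eqP; rewrite sqnorm_eq0 colE mulmxBl mul1mx {1 2}e !mulmxA.
        by rewrite -(mulmxA A L A) LA mulmx1 subrr.
      by rewrite mul0r.
    by rewrite z0 mulr0 mean_cst; split => //; exact: integrable_rv_cst.
  pose B : 'M[K]_(n, p) := delta_mx i j0.
  have resE : B - A *m E *m pinv (A *m E) *m B = ortho_proj A *m B.
    exact: exact_residualE.
  have nB : B <> A *m E *m pinv (A *m E) *m B.
    move/eqP; rewrite -subr_eq0 resE -sqnorm_eq0 sqnorm_mulmx_delta.
    by rewrite (negPf nz).
  have := risk_le rAE nB; rewrite resE frobenius_sqr sqnorm_mulmx_delta => H.
  have {}H : (\int[P]_w (f i w)%:E <= (s * sqnorm (col i (ortho_proj A)))%:E)%E.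
    apply: le_trans H; rewrite (_ : integral _ _ _ = 'E_P[f i])%E; last by rewrite unlock.
    apply: expectation_ge0_le => // w; rewrite /f indicE.
    case: (boolP (w \in F)) => [/set_mem Fw|_]; last by rewrite mul0r sqr_ge0.
    by rewrite mul1r (sketch_residualE (uG w Fw) i j0 EE).
  have fi : integrable_rv P (f i).
    apply/integrableP; split; first exact/measurable_EFinP.
    under eq_integral => w _ do rewrite /= ger0_norm//.
    exact: le_lt_trans H (ltry _).
  split => //; rewrite -lee_fin /mean /Rintegral fineK//.
  exact: integrable_fin_num fi.
have fS : integrable_rv P (fun w => \sum_i f i w).
  by apply: integrable_rv_sum => i; case: (fle i).
have blueF w : F w -> blue_risk A w + (n%:R - 2 * r%:R) <= \sum_i f i w.
  move=> Fw; have [rw nw] := Fw; rewrite blue_riskE//.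
  have -> : \sum_i f i w = sqnorm (1%:M - A *m sketch_solver (Om w) A).
    rewrite (sqnorm_cols (1%:M - _)); apply: eq_bigr => i _.
    by rewrite /f indicE mem_set// mul1r.
  rewrite sqnorm_sketch_residual//; last exact: uG.
  by rewrite addrC lerD2l; apply: sqnorm_blue_le => //; exact: uG.
have iX : integrable_rv P (blue_risk A).
  have := @integrable_rvD R disp T P _ _ fS (@integrable_rv_cst R disp T P (2 * r%:R)).
  apply: le_integrable => //; first exact/measurable_EFinP/measurable_blue_risk.
  move=> w _ /=; rewrite lee_fin !ger0_norm ?sqnorm_ge0//; last first.
    by rewrite addr_ge0 ?mulr_ge0// sumr_ge0.
  have [Fw|nF] := pselect (F w).
    by have := blueF w Fw; have : 0 <= n%:R :> R by []; lra.
  have -> : blue_risk A w = 0.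
    have [rw|nr] := pselect (regular_locus Om w); last exact: blue_risk_irregular.
    apply: blue_risk_degenerate; apply: contrapT => nd; exact: nF.
  by rewrite addr_ge0 ?mulr_ge0// sumr_ge0.
split => //.
have mle : mean P (blue_risk A) + (n%:R - 2 * r%:R) <= \sum_i mean P (f i).
  rewrite -mean_sum; last by move=> i; case: (fle i).
  rewrite -(mean_cst P (n%:R - 2 * r%:R)) -meanD//; last exact: integrable_rv_cst.
  apply: (le_mean (measurableC mF) PF) => //.
    by apply: integrable_rvD => //; exact: integrable_rv_cst.
  by move=> w /contrapT; exact: blueF.
have : \sum_i mean P (f i) <= s * (n%:R - r%:R).
  rewrite -(sqnorm_ortho_proj Aorth) (sqnorm_cols (ortho_proj A)) mulr_sumr.
  by apply: ler_sum => i _; case: (fle i).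
lra.
Qed.

End RiskBound.

(** * The maximum principle *)

Section Descent.
Context {R : realType} {k : scalar_kind} {disp : measure_display}.
Context {T : measurableType disp} (P : probability T R) {n l : nat}.
Local Notation K := (scalar R k).
Variables (Om : T -> 'M[K]_(n, l)) (mOm : random_matrix Om).
Hypothesis fullOm : {ae P, forall w, \rank (Om w) = l}.
Variable r : nat.

Definition potential (q : {poly R}) (A : 'M[K]_(n, r)) (w : T) : R :=
  q.[volratio (range_proj (Om w)) A].

Lemma measurable_horner (q : {poly R}) (f : T -> R) :
  measurable_fun setT f -> measurable_fun setT (fun w => q.[f w]).
Proof.
move=> mf; elim/poly_ind: q => [|q c IH].
  by under eq_fun do rewrite horner0; exact: measurable_cst.
under eq_fun do rewrite hornerMXaddC.
by apply: measurable_funD => //; exact: measurable_funM.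
Qed.

Lemma potential_bounded (q : {poly R}) : exists2 M : R, 0 <= M &
  forall A w, adjmx A *m A \in unitmx -> `|potential q A w| <= M.
Proof.
have [M M0 qM] := poly_bounded q 1; exists M => // A w uA; apply: qM.
by rewrite ger0_norm ?volratio_ge0// volratio_le1//; exact: range_proj_proj.
Qed.

Lemma integrable_potential (q : {poly R}) (A : 'M[K]_(n, r)) :
  adjmx A *m A \in unitmx -> integrable_rv P (potential q A).
Proof.
move=> uA; have [M M0 qM] := potential_bounded q.
apply: (@integrable_rv_bounded _ _ _ _ _ M) => [|w]; last exact: qM.
apply: measurable_horner; apply: measurable_funM; last exact: measurable_cst.
by apply: random_scalar_modulus; apply: random_scalar_det; exact: random_matrix_compress.
Qed.

Lemma potentialM (q : {poly R}) (A : 'M[K]_(n, r)) (C : 'M[K]_r) :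
  C \in unitmx -> potential q (A *m C) = potential q A.
Proof. by move=> uC; apply/funext => w; rewrite /potential volratioM. Qed.

Local Notation beta := (2 - (alphaK k)%:R : R).
Let a : R := beta * (l%:R - r%:R + 1) - 2.
Let b : R := beta * (n%:R - r%:R + 1) - 2.

Variable c : R.
Hypotheses (rl : (r < l)%N) (a0 : 0 <= a) (b0 : 0 <= b).
Hypothesis mean_le : forall A : 'M[K]_(n, r), adjmx A *m A = 1%:M -> generic P Om A ->
  integrable_rv P (blue_risk Om A) /\ mean P (blue_risk Om A) <= c.
Hypothesis gap : a * c < r%:R * b.

Lemma mean_bound_ge0 : 0 <= c.
Proof.
have [A gA] := generic_exists mOm fullOm (ltnW rl).
have [C uC CE] := orthonormalize (generic_gram gA).
have [iX] := mean_le CE (genericM uC gA).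
apply: le_trans; apply: Rintegral_ge0 => w _; exact: sqnorm_ge0.
Qed.

(** If none of the perturbed frames lowered the mean potential by [th], the mean sum of second
    differences would be at least [- (2 * N * th)], whereas the Laplacian estimate puts it below
    that. The decrease [th] is independent of [A]. *)
Lemma potential_descent : exists q : {poly R}, exists2 th : R, 0 < th &
  forall A : 'M[K]_(n, r), generic P Om A ->
  exists2 A' : 'M[K]_(n, r), generic P Om A' &
    mean P (potential q A') <= mean P (potential q A) - th.
Proof.
have c0 := mean_bound_ge0.
pose rb := r%:R * b; have gp : a * c < rb := gap.
have rb0 : 0 <= rb by rewrite mulr_ge0.
(* The margin of strict superharmonicity; each of the three error terms below is made at most
   [eta / 8]. *)
pose eta := 2 * rb - 2 * (a * c).
have eta0 : 0 < eta by rewrite /eta; lra.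
(* The cutoff makes the contribution [2 * rb * c / Y] of large [tr G^-1] to the slope defect
   small. *)
pose Y := 8 * (2 * rb * c + 1) / eta.
have rbc0 : 0 <= 2 * rb * c by rewrite !mulr_ge0.
have Y0 : 0 < Y by rewrite divr_gt0// mulr_gt0//; lra.
have hY : 2 * rb / Y * c <= eta / 8.
  have -> : 2 * rb / Y * c = eta / 8 * (2 * rb * c / (2 * rb * c + 1)).
    by rewrite /Y; field; rewrite !gt_eqF//; lra.
  rewrite ler_piMr ?divr_ge0 ?(ltW eta0)// ler_pdivrMr; lra.
pose D := r`!%:R ^+ 2 * Y ^+ r : R.
have D0 : 0 <= D by rewrite mulr_ge0 ?sqr_ge0// exprn_ge0// ltW.
pose Z := 4 * c + 2 * rb * D.
have Z0 : 0 <= Z by do 2?[apply: addr_ge0 | apply: mulr_ge0] => //; exact: mulr_ge0.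
(* [Z] collects the errors with a factor [1 / H]: the curvature term [4 / H * X] and the slope
   defect below the cutoff. *)
pose H := 8 * (Z + 1) / eta.
have H0 : 0 < H by rewrite divr_gt0// mulr_gt0//; lra.
have hH : Z / H <= eta / 8.
  have -> : Z / H = eta / 8 * (Z / (Z + 1)).
    by rewrite /H; field; rewrite !gt_eqF//; lra.
  rewrite ler_piMr ?divr_ge0 ?(ltW eta0)// ler_pdivrMr; lra.
have [q qP] := slow_log_poly H0.
have [C C0 qC] := poly_second_difference q.
pose N : R := (r * (n * 2))%:R.
have N0 : 0 <= N by [].
have NC0 : 0 <= N * C by rewrite mulr_ge0.
pose e0 := Num.min 1 (eta / (8 * (N * C + 1))).
have e00 : 0 < e0.
  by rewrite lt_min ltr01 divr_gt0// mulr_gt0//; lra.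
(* There are [N] triples of column, coordinate and unit direction, each used with two signs, so
   [2 * N * th] must stay below the guaranteed loss [e0 ^+ 2 * eta / 8]. *)
pose th := eta * e0 ^+ 2 / (16 * (2 * N + 1)).
have th0 : 0 < th.
  by rewrite divr_gt0 ?mulr_gt0 ?exprn_gt0//; lra.
have tb : 2 * N * th < e0 ^+ 2 * eta / 8.
  have -> : 2 * N * th = e0 ^+ 2 * eta / 8 * (N / (2 * N + 1)).
    by rewrite /th; field; rewrite gt_eqF//; lra.
  rewrite gtr_pMr ?divr_gt0 ?mulr_gt0 ?exprn_gt0// ltr_pdivrMr; lra.
have e01 : e0 <= 1 by rewrite ge_min lexx.
have tC t : t <= e0 -> N * C * t <= eta / 8.
  move=> te; have h : t <= eta / (8 * (N * C + 1)) by rewrite (le_trans te)// ge_min lexx orbT.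
  apply: (le_trans (ler_wpM2l NC0 h)).
  have -> : N * C * (eta / (8 * (N * C + 1))) = eta / 8 * (N * C / (N * C + 1)).
    by field; rewrite gt_eqF//; lra.
  rewrite ler_piMr ?divr_ge0 ?(ltW eta0)// ler_pdivrMr; lra.
have NE : N = (r * (n * 2))%:R by [].
have DE : D = r`!%:R ^+ 2 * Y ^+ r by [].
have etaE : eta = 2 * rb - 2 * (a * c) by [].
have ZE : Z = 4 * c + 2 * rb * D by [].
have rbE : rb = r%:R * b by [].
clearbody th e0 N H Z D Y eta rb.
exists q, th => // A1 gA1.
have [U uU Aorth] := orthonormalize (generic_gram gA1).
rewrite -(potentialM q A1 uU).
have gA := genericM uU gA1; move: (A1 *m U) Aorth gA => A Aorth gA.
have e02 : e0 / 2 < e0 by lra.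
(* Genericity dictates [t], which depends on [A]; the lower end [e0 / 2] keeps the gain of order
   [t ^+ 2] above a threshold independent of [A]. *)
have [t /andP[t1 t2] gt] := generic_perturb mOm Aorth gA e02.
have t0 : 0 < t by rewrite (lt_trans _ t1)// divr_gt0.
have te1 : t <= 1 := le_trans (ltW t2) e01.
have {}tC := tC _ (ltW t2).
apply: contrapT => /forall2NP nA.
have big A' : generic P Om A' -> mean P (potential q A) - th <= mean P (potential q A').
  by move=> gA'; case: (nA A') => // /negP; rewrite -ltNge => /ltW.
have uA := generic_gram gA.
have iA := integrable_potential q uA.
have iP i j b' : integrable_rv P (potential q (perturb A i j b' t)) /\
    integrable_rv P (potential q (perturb A i j b' (- t))).
  have [g1 g2] := gt i j b'.
  by split; apply: integrable_potential; [exact: generic_gram g1|exact: generic_gram g2].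
have [iX mX] := mean_le Aorth gA.
pose S w := \sum_i \sum_j \sum_b' (potential q (perturb A i j b' t) w
   + potential q (perturb A i j b' (- t)) w - 2 * potential q A w).
have iterm i j b' : integrable_rv P (fun w => potential q (perturb A i j b' t) w
   + potential q (perturb A i j b' (- t)) w - 2 * potential q A w).
  have [i1 i2] := iP i j b'.
  by apply: integrable_rvB; [exact: integrable_rvD|exact: integrable_rvZ].
have iS : integrable_rv P S.
  by apply: integrable_rv_sum => i; apply: integrable_rv_sum => j; exact: integrable_rv_sum.
have Slow : - (2 * N * th) <= mean P S.
  rewrite /S mean_sum; last first.
    by move=> i; apply: integrable_rv_sum => j; exact: integrable_rv_sum.
  apply: (@le_trans _ _ (\sum_(i < r) \sum_(j < n) \sum_(b' : bool) - (2 * th))).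
    rewrite !(sumr_const, card_ord, card_bool).
    have -> : - (2 * th) *+ 2 *+ n *+ r = N * - (2 * th).
      by rewrite NE [RHS]mulr_natl (mulnC r) (mulnC n) [RHS]mulrnA [X in _ = X *+ r]mulrnA.
    by rewrite mulrN mulrCA mulrA.
  apply: ler_sum => i _; rewrite mean_sum; last by move=> j; exact: integrable_rv_sum.
  apply: ler_sum => j _; rewrite mean_sum//; apply: ler_sum => b' _.
  have [i1 i2] := iP i j b'; have [g1 g2] := gt i j b'.
  rewrite meanB ?meanD ?meanZ//; [|exact: integrable_rvD|exact: integrable_rvZ].
  have := big _ g1; have := big _ g2.
  move: (mean P (potential q A)) (mean P (potential q (perturb A i j b' t)))
    (mean P (potential q (perturb A i j b' (- t)))) => m0 m1 m2 h2 h1.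
  rewrite lerBrDr; apply: le_trans (lerD h1 h2).
  by rewrite le_eqVlt; apply/orP; left; apply/eqP; ring.
pose al1 := t ^+ 2 * (2 * a + 4 / H + 2 * rb / Y).
pose al0 := t ^+ 2 * (2 * rb * (D / H) - 2 * rb) + N * C * t ^+ 3.
have Sup : mean P S <= al1 * mean P (blue_risk Om A) + al0.
  rewrite -meanZ// -(mean_cst P al0) -meanD//; last 2 first.
  - exact: integrable_rvZ.
  - exact: integrable_rv_cst.
  pose Nul := ~` regular_locus Om `|` degenerate Om A.
  have mN : measurable Nul.
    apply: measurableU; last exact: measurable_degenerate.
    exact/measurableC/measurable_regular_locus.
  have PN : P Nul = 0.
    apply: measure_setU0 => //.
    - exact/measurableC/measurable_regular_locus.
    - exact: measurable_degenerate.
    - exact: regular_locus_full.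
  apply: (le_mean mN PN) => //.
    by apply: integrable_rvD; [exact: integrable_rvZ|exact: integrable_rv_cst].
  move=> w /not_orP[/contrapT rw nw].
  have uG := not_degenerate nw; have Qp := range_proj_proj (Om w).
  have x0 := volratio_orth_gt0 Aorth uG; have x1 := volratio_orth_le1 Qp Aorth.
  have [k1 k0 kH ka0 kaH] := qP _ x0 x1.
  have := sum_second_difference_le Qp (trace_range_proj rw) Aorth uG qC H0 k1 ka0 kaH t0 te1 a0.
  have dl := slope_defect_le Qp Aorth uG H0 Y0 k0 kH.
  rewrite blue_riskE// /S /potential; move/le_trans; apply.
  rewrite -/a -/b -rbE -NE -DE in dl *.
  set X := sqnorm _ in dl *; set dd := 1 - _ in dl *.
  have -> : al1 * X + al0 = t ^+ 2 * ((2 * a + 4 / H + 2 * rb / Y) * X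
      + (2 * rb * (D / H) - 2 * rb)) + N * C * t ^+ 3.
    by rewrite /al1 /al0; ring.
  rewrite lerD2r ler_pM2l ?exprn_gt0//.
  have h : 2 * rb * dd <= 2 * rb * (D / H + X / Y) by rewrite ler_wpM2l ?mulr_ge0.
  apply: (le_trans (lerD (lexx _) h)).
  by rewrite le_eqVlt; apply/orP; left; apply/eqP; ring.
have t20 : 0 < t ^+ 2 by rewrite exprn_gt0.
have up : al1 * mean P (blue_risk Om A) + al0 <= - (t ^+ 2 * (eta / 2)).
  have al10 : 0 <= al1.
    by rewrite mulr_ge0 ?(ltW t20)// !addr_ge0 ?mulr_ge0 ?divr_ge0 ?invr_ge0 ?(ltW H0) ?(ltW Y0).
  apply: (@le_trans _ _ (al1 * c + al0)); first by rewrite lerD2r ler_wpM2l.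
  have t3 : N * C * t ^+ 3 <= t ^+ 2 * (eta / 8).
    by rewrite (_ : N * C * t ^+ 3 = t ^+ 2 * (N * C * t)) ?ler_pM2l//; ring.
  rewrite /al1 /al0.
  have : (2 * a + 4 / H + 2 * rb / Y) * c + (2 * rb * (D / H) - 2 * rb) <= - (5 / 8 * eta).
    have -> : (2 * a + 4 / H + 2 * rb / Y) * c + (2 * rb * (D / H) - 2 * rb) =
      - eta + 2 * rb / Y * c + Z / H by rewrite ZE etaE; ring.
    lra.
  move=> h; have := ler_wpM2l (ltW t20) h; lra.
have tt : t ^+ 2 * (eta / 2) >= e0 ^+ 2 * eta / 8.
  have : (e0 / 2) ^+ 2 <= t ^+ 2 by rewrite lerXn2r// ?nnegrE ltW// divr_gt0.
  rewrite exprMn; move: (e0 ^+ 2) (t ^+ 2) => u v; nra.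
lra.
Qed.

(** The mean potentials of generic frames have a finite infimum; a frame within [th] of it could be
    lowered by [th], to below the infimum. *)
Lemma no_descent : False.
Proof.
have [q [th th0 descent]] := potential_descent.
have [M M0 qM] := potential_bounded q.
pose S := [set mean P (potential q A) | A in [set A | generic P Om A]].
have lb : lbound S (- M).
  move=> _ [A gA <-]; rewrite -(mean_cst P (- M)).
  apply: (le_mean measurable0 (measure0 P)); first exact: integrable_rv_cst.
    exact: integrable_potential (generic_gram gA).
  by move=> w _; have := qM A w (generic_gram gA); rewrite ler_norml => /andP[].
have [A0 gA0] := generic_exists mOm fullOm (ltnW rl).
have hS : has_inf S by split; [exists (mean P (potential q A0)), A0|exists (- M)].
have [_ [A gA <-] Alt] := inf_adherent th0 hS.
have [A' gA' A'le] := descent A gA.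
have : inf S <= mean P (potential q A') by apply: ge_inf; [exists (- M)|exists A'].
lra.
Qed.

End Descent.

Theorem theorem2p2 (R : realType) (k : scalar_kind)
    (disp : measure_display) (T : measurableType disp) (P : probability T R)
    (n l : nat) (n_gt0 : (0 < n)%N) (l_gt0 : (0 < l)%N) (le_ln : (l <= n)%N)
    (Omega : T -> 'M[scalar R k]_(n, l))
    (Omega_random : random_matrix Omega)
    (Omega_full : {ae P, forall w, \rank (Omega w) = l})
    (r : nat) (lt_r : (r < l - alphaK k)%N)
    (d p : nat) (d_gt0 : (0 < d)%N) (p_gt0 : (0 < p)%N) (le_rd : (r <= d)%N) :
  ((1 + (n%:R - l%:R) / (n%:R - r%:R)
        * (r%:R / (l%:R - r%:R - (alphaK k)%:R)))%R%:E <=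
   ereal_sup [set x : \bar R |
     exists (A : 'M[scalar R k]_(n, d)) (B : 'M[scalar R k]_(n, p)),
       [/\ \rank A = r,
           B <> (A *m pinv A *m B)%R
         & x = 'E_P [fun w =>
                  (frobenius (B - A *m pinv (adjmx (Omega w) *m A)
                                    *m (adjmx (Omega w) *m B)) ^+ 2)%R]
               / ((frobenius (B - A *m pinv A *m B) ^+ 2)%R)%:E]])%E.
Proof.
set al := alphaK k in lt_r *.
set S := ereal_sup _; set c := (1 + _)%R; rewrite leNgt; apply/negP => Sc.
(* A real [s] is needed for the risk bounds; if the supremum is [-oo], any real number below [c]
   serves. *)
have [s Ss sc] : exists2 s : R, (S <= s%:E)%E & s < c.
  move: Sc; case: (S) => [x|//|_]; first by rewrite lte_fin; exists x.
  by exists (c - 1); rewrite ?leNye// ltrBlDr ltrDl.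
have al_le1 : (al <= 1)%N by rewrite /al; case: (k).
have rl : (r + al < l)%N by lia.
have rl' : (r%:R + al%:R + 1 <= l%:R :> R) by rewrite -natrD natr1 ler_nat.
have ln' : (l%:R <= n%:R :> R) by rewrite ler_nat.
have alE : al = 0%N \/ al = 1%N by lia.
have r0 : 0 <= r%:R :> R by [].
have H (A : 'M[scalar R k]_(n, d)) (B : 'M[scalar R k]_(n, p)) : \rank A = r -> B <> A *m pinv A *m B ->
  ('E_P [fun w => (frobenius (B - A *m pinv (adjmx (Omega w) *m A)
                                    *m (adjmx (Omega w) *m B)) ^+ 2)%R]
   <= (s * frobenius (B - A *m pinv A *m B) ^+ 2)%:E)%E.
  move=> rA nB; have D0 : 0 < frobenius (B - A *m pinv A *m B) ^+ 2.
    rewrite frobenius_sqr lt_def sqnorm_ge0 andbT sqnorm_eq0 subr_eq0.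
    exact/eqP.
  rewrite EFinM -lee_pdivrMr//; apply: le_trans Ss; apply: ereal_sup_ubound.
  by exists A, B; split => //; rewrite inver gt_eqF.
have key := mean_blue_risk_le Omega_random Omega_full le_rd p_gt0 H.
apply: (@no_descent R k disp T P n l Omega Omega_random Omega_full r
  (s * (n%:R - r%:R) - n%:R + 2 * r%:R)) => //.
- by lia.
- by rewrite -/al; case: alE rl' => ->; lra.
- by rewrite -/al; case: alE rl' => ->; lra.
rewrite -/al.
have nr : 0 < n%:R - r%:R :> R by case: alE rl' => ->; lra.
have lr : 0 < l%:R - r%:R - al%:R :> R by lra.
(* At [s = c] the bound on the mean of [tr G^-1] equals the critical value [r b / a], so [s < c] is
   exactly the strict gap that [no_descent] refutes. *)
have cE : (c * (n%:R - r%:R) - n%:R + 2 * r%:R) * (l%:R - r%:R - al%:R) =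
  r%:R * (n%:R - r%:R - al%:R).
  by rewrite /c; field; rewrite !gt_eqF.
have h : (s * (n%:R - r%:R) - n%:R + 2 * r%:R) * (l%:R - r%:R - al%:R) <
  r%:R * (n%:R - r%:R - al%:R).
  by rewrite -cE ltr_pM2r// ltrD2r ltrD2r ltr_pM2r.
case: alE h => ->; lra.
Qed.
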